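(* For all $\alpha\in\mathbb{R}$ and $(u_1,u_2)\in\mathbb{R}^2$, $E_2(\alpha;u_1,u_2)=\int_{\mathbb{R}^2}du_1'\,du_2'\,e^{-\pi(u_1-u_1')^2-\pi(u_2-u_2')^2}\operatorname{sign}(u_2')\operatorname{sign}(u_1'+\alpha u_2')$; equivalently, $E_2(\alpha;\cdot,\cdot)$ is obtained by applying the heat kernel operator $e^{\frac{1}{4\pi}(\partial_{u_1}^2+\partial_{u_2}^2)}$ to the locally constant function $\operatorname{sign}(u_2)\operatorname{sign}(u_1+\alpha u_2)$.
   Context: $M_1(u)=-\operatorname{sign}(u)\operatorname{Erfc}(|u|\sqrt{\pi})$. For $u_1\neq0$, $u_2\neq\alpha u_1$: $M_2(\alpha;u_1,u_2)=-\frac{1}{\pi^2}\int_{\mathbb{R}-\mathrm{i}u_1}dz_1\int_{\mathbb{R}-\mathrm{i}u_2}dz_2\,\frac{e^{-\pi z_1^2-\pi z_2^2-2\pi\mathrm{i}(u_1z_1+u_2z_2)}}{z_1(z_2-\alpha z_1)}$ and $E_2(\alpha;u_1,u_2)=M_2(\alpha;u_1,u_2)+\operatorname{sign}(u_1)M_1(u_2)+\operatorname{sign}(u_2-\alpha u_1)M_1\!\left(\frac{u_1+\alpha u_2}{\sqrt{1+\alpha^2}}\right)+\operatorname{sign}(u_2)\operatorname{sign}(u_1+\alpha u_2)$, extended to a $C^\infty$ function on $\mathbb{R}^2$ denoted by the same symbol. *)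

(* Defs.v *)
From mathcomp Require Import all_boot all_order all_algebra.
From mathcomp Require Import complex.
From mathcomp Require Import all_classical all_reals all_analysis.

Set Implicit Arguments.
Unset Strict Implicit.
Unset Printing Implicit Defensive.

Import Order.TTheory GRing.Theory Num.Theory.
Import numFieldNormedType.Exports.

Local Open Scope classical_set_scope.
Local Open Scope complex_scope.
Local Open Scope ring_scope.

Definition expC (R : realType) (z : R[i]) : R[i] :=
  (expR (complex.Re z))%:C * (cos (complex.Im z) +i* sin (complex.Im z)).

Definition cintegral (R : realType) (f : R -> R[i]) : R[i] :=
  (\int[@lebesgue_measure R]_x complex.Re (f x)) +i*
  (\int[@lebesgue_measure R]_x complex.Im (f x)).

(** Contour integral of [f] along the horizontal line [R + i c], oriented from
    left to right. *)
Definition line_integral (R : realType) (c : R) (f : R[i] -> R[i]) : R[i] :=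
  cintegral (fun x : R => f (x +i* c)).

Definition erfc (R : realType) (x : R) : R :=
  2 / Num.sqrt pi *
  \int[@lebesgue_measure R]_(t in `[x, +oo[) expR (- t ^+ 2).

(** Here and below [Num.sg 0 = 0]: with this convention [E2_formula] is continuous
    on [E2_domain], including at [u2 = 0] and [u1 + alpha u2 = 0]. *)
Definition M1 (R : realType) (u : R) : R :=
  - Num.sg u * erfc (`|u| * Num.sqrt pi).

(** [dz1] is the outer integration and [dz2] the inner one; the poles [z1 = 0]
    and [z2 = alpha z1] are avoided when [u1 != 0] and [u2 != alpha u1]. *)
Definition M2 (R : realType) (alpha u1 u2 : R) : R[i] :=
  - (pi ^- 2)%:C *
  line_integral (- u1) (fun z1 : R[i] =>
    line_integral (- u2) (fun z2 : R[i] =>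
      expC (- pi%:C * z1 ^+ 2 - pi%:C * z2 ^+ 2
            - 2 * pi%:C * (0 +i* 1) * (u1%:C * z1 + u2%:C * z2))
      / (z1 * (z2 - alpha%:C * z1)))).

Definition E2_domain (R : realType) (alpha : R) : set (R * R) :=
  [set u | u.1 != 0 /\ u.2 != alpha * u.1].

(** The formula for [E2]; meaningful on [E2_domain alpha] only. *)
Definition E2_formula (R : realType) (alpha : R) (u : R * R) : R[i] :=
  M2 alpha u.1 u.2
  + (Num.sg u.1 * M1 u.2
     + Num.sg (u.2 - alpha * u.1)
       * M1 ((u.1 + alpha * u.2) / Num.sqrt (1 + alpha ^+ 2))
     + Num.sg u.2 * Num.sg (u.1 + alpha * u.2))%:C.

(** [Ck n f]: [f] has continuous partial derivatives of all orders [<= n]. *)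
Fixpoint Ck (R : realType) (n : nat) (f : R * R -> R) : Prop :=
  match n with
  | 0%N => continuous f
  | m.+1 =>
      [/\ continuous f,
          forall u, derivable f u (1, 0) /\ derivable f u (0, 1),
          Ck m ('D_(1, 0) f : R * R -> R) &
          Ck m ('D_(0, 1) f : R * R -> R)]
  end.

Definition smooth (R : realType) (f : R * R -> R[i]) : Prop :=
  forall n, Ck n (fun u => complex.Re (f u)) /\ Ck n (fun u => complex.Im (f u)).

(** The smooth extension of [E2_formula alpha] to the whole plane.  It is unique
    because [E2_domain alpha] is dense; the default value [0] would be taken
    only if there were no such extension. *)
Definition E2 (R : realType) (alpha : R) : R * R -> R[i] :=
  xget (fun=> 0)
    [set E : R * R -> R[i] |
      smooth E /\ {in E2_domain alpha, E =1 E2_formula alpha}].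

(** The heat operator [exp (t (d^2/du1^2 + d^2/du2^2))] for [t > 0], that is,
    convolution with the heat kernel of the plane. *)
Definition heat_operator (R : realType) (t : R) (f : R * R -> R) (u : R * R) : R :=
  \int[(@lebesgue_measure R \x @lebesgue_measure R)%E]_v
    ((4 * pi * t)^-1 *
     expR (- ((u.1 - v.1) ^+ 2 + (u.2 - v.2) ^+ 2) / (4 * t)) * f v).

(* Main.v *)
(** On the contour of [M2], completing the squares makes the exponent real, so that
    [M2] is [exp (- pi |u|^2)] times the integral of the Gaussian
    [exp (- pi (x1^2 + x2^2))] against [1 / ((x1 - i u1) (x2 - alpha x1 - i b))] with
    [b = u2 - alpha u1].  Writing each pole as the Fourier transform of a one-sided
    exponential and applying Fubini, the Gaussian gets replaced by its own Fourier
    transform, and [M2] becomes the real integral of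
    [(sg u1 + sg s) (sg b + sg t) exp (- pi (u1 + s - alpha t)^2 - pi (u2 + t)^2)].
    Substituting [v2 = - t] and [v1 = alpha t - s] and expanding the product of
    signs produces the Gaussian average of [sg v2 * sg (v1 + alpha v2)] together with
    error-function terms, and these cancel against the terms of [E2] containing [M1].
    The Gaussian average is smooth, and the domain of the formula is dense, so it is
    the smooth extension. *)

From HB Require Import structures.
Require Import Defs.
From mathcomp Require Import all_boot all_order all_algebra.
From mathcomp Require Import complex.
From mathcomp Require Import all_classical all_reals all_analysis.
From mathcomp Require Import measurable_realfun ring lra.

Set Implicit Arguments.
Unset Strict Implicit.
Unset Printing Implicit Defensive.

Import Order.TTheory GRing.Theory Num.Theory.
Import numFieldNormedType.Exports.

Local Open Scope classical_set_scope.
Local Open Scope complex_scope.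
Local Open Scope ring_scope.

(** * Integrability and Fubini for real-valued integrals *)

(** The functions [1 / (x - i a)] are not integrable on the line, so they are never exchanged with
    an integral on their own. The Gaussian in [z] and the exponentials in [w] are kept together in
    one integral over four real variables, where the oscillating factor is bounded and convergence
    is absolute. Integrals being real-valued, that factor is carried as [c cos + d sin].

    Smoothness cannot be read off the plane integral by differentiating its signs. Once [v1] is
    integrated out, the integrand is [gam (u2 - v) * sg v * gerf (u1 + alpha v)], with [gerf] a
    rescaled error function: [u1] and [u2] now occur in smooth factors only. Differentiation
    multiplies the Gaussian by a polynomial or replaces [gerf] by a derivative, so all partial
    derivatives stay in one family of bounded functions, and bounded partials already give joint
    continuity. *)

Section integrals.
Context d (T : measurableType d) (R : realType) (mu : {measure set T -> \bar R}).
Implicit Types f g h : T -> R.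

Lemma integrable_le f g : measurable_fun setT f -> (forall x, `|f x| <= g x) ->
  mu.-integrable setT (EFin \o g) -> mu.-integrable setT (EFin \o f).
Proof.
move=> mf fg; apply: le_integrable => //; first exact/measurable_EFinP.
by move=> x _ /=; rewrite lee_fin (le_trans (fg x))// ler_norm.
Qed.

Lemma integrable_mull_bounded f g (M : R) : measurable_fun setT f ->
  (forall x, `|f x| <= M) ->
  mu.-integrable setT (EFin \o g) -> mu.-integrable setT (EFin \o (fun x => f x * g x)).
Proof.
move=> mf fM ig.
have := integrableMr measurableT mf _ ig; apply.
exists M; split; first exact: num_real.
by move=> x Mx y _ /=; exact: le_trans (fM y) (ltW Mx).
Qed.

Lemma integrable_mulr_bounded f g (M : R) : measurable_fun setT f ->
  (forall x, `|f x| <= M) ->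
  mu.-integrable setT (EFin \o g) -> mu.-integrable setT (EFin \o (fun x => g x * f x)).
Proof.
move=> mf fM ig; have := integrable_mull_bounded mf fM ig.
by under eq_fun do rewrite mulrC.
Qed.

Lemma integrable_scale (k : R) f :
  mu.-integrable setT (EFin \o f) -> mu.-integrable setT (EFin \o (fun x => k * f x)).
Proof. by move/(integrableZl measurableT k); apply: eq_integrable. Qed.

Lemma integrable_opp f :
  mu.-integrable setT (EFin \o f) -> mu.-integrable setT (EFin \o (fun x => - f x)).
Proof. by move/(integrableN); apply: eq_integrable. Qed.

Lemma integrable_add f g :
  mu.-integrable setT (EFin \o f) -> mu.-integrable setT (EFin \o g) ->
  mu.-integrable setT (EFin \o (fun x => f x + g x)).
Proof. by move=> fi /(integrableD measurableT fi); apply: eq_integrable. Qed.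

Lemma integrable_measurable f : mu.-integrable setT (EFin \o f) -> measurable_fun setT f.
Proof. by move/measurable_int/measurable_EFinP. Qed.

(** A real iterated integral applies [fine] to each inner integral, which alters it wherever it is
    infinite. For an integrable function of two variables this happens on a null set only. *)
Lemma Rintegral_fine (F : T -> \bar R) : measurable_fun setT F ->
  {ae mu, forall x, F x \is a fin_num} ->
  (\int[mu]_x (fine (F x))%:E = \int[mu]_x F x)%E.
Proof.
move=> mF finF; apply: ae_eq_integral => //.
  by apply/measurable_EFinP; apply: (measurableT_comp (f := fine)) => //;
    exact: fine_measurable.
by apply: filterS finF => x Fx _; rewrite fineK.
Qed.

End integrals.

Section fubini.
Context d1 d2 (T1 : measurableType d1) (T2 : measurableType d2) (R : realType).
Variables (m1 : {sigma_finite_measure set T1 -> \bar R})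
  (m2 : {sigma_finite_measure set T2 -> \bar R}).

Lemma Rfubini1 (f : T1 * T2 -> R) : (m1 \x m2)%E.-integrable setT (EFin \o f) ->
  \int[m1]_x \int[m2]_y f (x, y) = \int[(m1 \x m2)%E]_z f z.
Proof.
move=> intf; rewrite {1}/Rintegral Rintegral_fine.
- by rewrite (integral12_prod_meas1 intf).
- exact: measurable_fubini_F intf.
- have := ae_integrable1 intf; apply: filterS => x; exact: integrable_fin_num.
Qed.

Lemma integrable_Rfubini (f : T1 * T2 -> R) :
  (m1 \x m2)%E.-integrable setT (EFin \o f) ->
  m1.-integrable setT (EFin \o (fun x => \int[m2]_y f (x, y))).
Proof.
move=> intf; have iF := integrable_fubini_F intf.
apply: le_integrable iF => //.
  apply/measurable_EFinP; apply: (measurableT_comp (f := fine));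
    last exact: measurable_fubini_F intf.
  exact: fine_measurable.
by move=> x _ /=; rewrite /Rintegral /fubini_F /=; case: (integral _ _ _) => //= *;
  rewrite ?normr0 ?leey.
Qed.

Lemma Rfubini2 (f : T1 * T2 -> R) : (m1 \x m2)%E.-integrable setT (EFin \o f) ->
  \int[m2]_y \int[m1]_x f (x, y) = \int[(m1 \x m2)%E]_z f z.
Proof.
move=> intf; rewrite {1}/Rintegral Rintegral_fine.
- by rewrite (integral21_prod_meas1 intf).
- exact: measurable_fubini_G intf.
- have := ae_integrable2 intf; apply: filterS => x; exact: integrable_fin_num.
Qed.

Lemma integrable_prod (f : T1 -> R) (g : T2 -> R) :
  m1.-integrable setT (EFin \o f) -> m2.-integrable setT (EFin \o g) ->
  (m1 \x m2)%E.-integrable setT (EFin \o (fun z => f z.1 * g z.2)).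
Proof.
move=> intf intg.
have mf := integrable_measurable intf; have mg := integrable_measurable intg.
apply/integrable12ltyP.
  by apply/measurable_EFinP/measurable_funM; apply: measurableT_comp.
rewrite [X in (X < _)%E](_ : _ = (\int[m1]_x `|(f x)%:E|) * \int[m2]_y `|(g y)%:E|)%E;
  last first.
  rewrite -ge0_integralZr//; last 2 first.
  - by apply: measurableT_comp => //; exact/measurable_EFinP.
  - exact: integral_ge0.
  apply: eq_integral => x _; rewrite -ge0_integralZl//; last first.
    by apply: measurableT_comp => //; exact/measurable_EFinP.
  by apply: eq_integral => y _ /=; rewrite normrM EFinM.
move/integrableP: intf => [_]; move/integrableP: intg => [_] /= g1 f1.
apply: lte_mul_pinfty => //; first exact: integral_ge0.
by rewrite ge0_fin_numE//; exact: integral_ge0.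
Qed.

Lemma Rintegral_prod (f : T1 -> R) (g : T2 -> R) :
  m1.-integrable setT (EFin \o f) -> m2.-integrable setT (EFin \o g) ->
  \int[(m1 \x m2)%E]_z (f z.1 * g z.2) = (\int[m1]_x f x) * \int[m2]_y g y.
Proof.
move=> intf intg; rewrite -Rfubini1; last exact: integrable_prod.
by rewrite -RintegralZr//; apply: eq_Rintegral => x _ /=; rewrite RintegralZl.
Qed.

(** The library provides the factories below but no canonical structure of
    sigma-finite measure on a product, which iterating Fubini requires. *)
Definition sigma_finite_product : {sigma_finite_measure set (T1 * T2)%type -> \bar R} :=
  HB.pack (m1 \x m2)%E
    (lebesgue_integral_fubini.measure_function_Measure_isSigmaFinite__to__measure_function_isSFinite m1 m2)
    (lebesgue_integral_fubini.measure_function_Measure_isSigmaFinite__to__measure_function_isSigmaFinite m1 m2).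

(** The integrand is dominated by [M * |f x| * |g y|]. In the application both variables range over
    planes and [h] is the oscillating Fourier factor. *)
Lemma Rfubini_bounded (f : T1 -> R) (g : T2 -> R) (h : T1 * T2 -> R) (M : R) :
  m1.-integrable setT (EFin \o f) -> m2.-integrable setT (EFin \o g) ->
  measurable_fun setT h -> (forall z, `|h z| <= M) ->
  let F x y := f x * g y * h (x, y) in
  m1.-integrable setT (EFin \o (fun x => \int[m2]_y F x y)) /\
  \int[m1]_x \int[m2]_y F x y = \int[m2]_y \int[m1]_x F x y.
Proof.
move=> intf intg mh hM F.
have iF : (m1 \x m2)%E.-integrable setT (EFin \o (fun z => F z.1 z.2)).
  have := integrable_mulr_bounded mh hM (integrable_prod intf intg).
  by apply: eq_integrable => // -[x y].
split; first exact: integrable_Rfubini iF.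
by rewrite (Rfubini1 iF) -(Rfubini2 iF).
Qed.

End fubini.

(** * Invariance of Lebesgue measure under translation and reflection *)

Section translation.
Context (R : realType).
Notation mu := (@lebesgue_measure R).

Definition translation (c x : R) : measurableTypeR R := x + c.

Lemma measurable_translation (c : R) : measurable_fun setT (translation c).
Proof. exact: measurable_funD. Qed.

(** Lebesgue measure is determined by its values on half-open intervals, and translation preserves
    their length. *)
Lemma lebesgue_measureD (c : R) (A : set R) : measurable A ->
  pushforward mu (translation c) A = mu A.
Proof.
move=> mA; apply/esym/lebesgue_measure_unique => //.
  exact: measurable_translation.
move=> mt X /ocitvP[->|[[a b] /= ab ->]]; first by rewrite !measure0.
rewrite /pushforward.
have -> : translation c @^-1` `]a, b] = `](a - c), (b - c)]%classic.
  by apply/seteqP; split=> x /=; rewrite /translation !in_itv/=; lra.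
by rewrite !lebesgue_measure_itv/= !lte_fin ltrD2r -!EFinD; case: ifPn => // _;
  congr _%:E; lra.
Qed.

Lemma Rintegral_invariant (phi : measurableTypeR R -> measurableTypeR R) (f : R -> R) :
  measurable_fun setT phi ->
  (forall A, measurable A -> pushforward mu phi A = mu A) ->
  mu.-integrable setT (EFin \o f) ->
  mu.-integrable setT (EFin \o (fun x : R => f (phi x))) /\
  \int[mu]_x f (phi x) = \int[mu]_x f x.
Proof.
move=> mphi phiE intf; have mf := integrable_measurable intf.
have mfc : measurable_fun setT (fun x : R => f (phi x)).
  exact: (measurableT_comp mf).
have ic : mu.-integrable setT (EFin \o (fun x : R => f (phi x))).
  apply/integrableP; split; first exact/measurable_EFinP.
  have := ge0_integral_pushforward mphi (@lebesgue_measure R) (D := setT)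
    (f := fun x => `|(f x)%:E|%E) measurableT.
  rewrite preimage_setT => /= <- //; last first.
    by apply/measurable_EFinP; exact: measurableT_comp.
  rewrite (eq_measure_integral mu) //; last by move=> A mA _; exact: phiE.
  by case/integrableP: intf.
split=> //; rewrite /Rintegral; congr fine.
have := integral_pushforward mphi (mu := @lebesgue_measure R) (D := setT)
    (f := EFin \o f) _ _ measurableT.
rewrite preimage_setT => /= <- //; last exact/measurable_EFinP.
by apply: eq_measure_integral => A mA _; exact: phiE.
Qed.

Lemma Rintegral_transl (c : R) (f : R -> R) : mu.-integrable setT (EFin \o f) ->
  mu.-integrable setT (EFin \o (fun x => f (x + c))) /\
  \int[mu]_x f (x + c) = \int[mu]_x f x.
Proof.
apply: (@Rintegral_invariant (translation c)) => [|A].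
  exact: measurable_translation.
exact: lebesgue_measureD.
Qed.

Lemma Rintegral_opp (f : R -> R) : mu.-integrable setT (EFin \o f) ->
  mu.-integrable setT (EFin \o (fun x => f (- x))) /\
  \int[mu]_x f (- x) = \int[mu]_x f x.
Proof.
apply: (@Rintegral_invariant -%R) => [|A]; last exact: lebesgue_measureN.
exact: measurable_funN.
Qed.

End translation.

(** * The fundamental theorem of calculus on unbounded intervals *)

Section FTC.
Context (R : realType).
Notation mu := (@lebesgue_measure R).

(** Dominated convergence for the restrictions of [f] to the sets [A n], with [|f|] as dominating
    function. *)
Lemma cvg_Rintegral_exhaustion (D : set R) (A : nat -> set R) (f : R -> R) :
  measurable D -> (forall n, measurable (A n)) -> (forall n, A n `<=` D) ->
  (forall x, D x -> \forall n \near \oo, A n x) ->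
  mu.-integrable D (EFin \o f) ->
  \int[mu]_(x in A n) f x @[n --> \oo] --> \int[mu]_(x in D) f x.
Proof.
move=> mD mA AD DA intf.
apply: fine_cvg; rewrite fineK; last exact: integrable_fin_num.
have -> : (fun n => \int[mu]_(x in A n) (f x)%:E)%E =
    (fun n => \int[mu]_(x in D) ((EFin \o f) \_ (A n)) x)%E.
  apply/funext => n; rewrite -integral_mkcondr.
  by rewrite setIidr.
apply: (@dominated_cvg _ _ R mu D mD (fun n => (EFin \o f) \_ (A n)) (EFin \o f) (abse
  \o (EFin \o f))).
- move=> n; apply/(measurable_restrict _ _ _) => //; first exact: mA.
  by apply: measurable_funS (measurable_int _ intf) => //; exact: subIsetl.
- move=> x Dx; apply: cvg_near_cst; near=> n.
  by rewrite patchE mem_set//; near: n; exact: DA.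
- by move=> x Dx.
- exact: integrable_abse.
- move=> n x Dx; rewrite patchE; case: ifP => //= _.
  by rewrite normr0 lee_fin.
Unshelve. all: by end_near. Qed.

Lemma Rintegral_FTC2 (f F : R -> R) (a b : R) : a < b -> continuous f ->
  (forall x : R, is_derive x 1 F (f x)) ->
  \int[mu]_(x in `[a, b]) f x = F b - F a.
Proof.
move=> ab cf dF; rewrite /Rintegral (continuous_FTC2 (F := F)) //.
- exact: continuous_subspaceT.
- have cF : continuous F.
    move=> x; apply: differentiable_continuous; apply/derivable1_diffP.
    by have [] := dF x.
  split.
  + by move=> x _; have [] := dF x.
  + by apply: cvg_at_right_filter; exact: cF.
  + by apply: cvg_at_left_filter; exact: cF.
- by move=> x _; rewrite derive1E; have [] := dF x.
Qed.

Lemma Rintegral_FTC2y (f F : R -> R) (a l : R) : continuous f ->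
  mu.-integrable `[a, +oo[ (EFin \o f) ->
  (forall x : R, is_derive x 1 F (f x)) -> F x @[x --> +oo] --> l ->
  \int[mu]_(x in `[a, +oo[) f x = l - F a.
Proof.
move=> cf intf dF Fl.
(* [n.+1] rather than [n]: the interval must be nondegenerate already at [n = 0]. *)
have h1 : \int[mu]_(x in `[a, a + n.+1%:R]) f x @[n --> \oo] --> \int[mu]_(x in `[a,
  +oo[) f x.
  apply: cvg_Rintegral_exhaustion => //.
    by move=> n x /=; rewrite !in_itv/= andbT => /andP[].
  move=> x /=; rewrite in_itv/= andbT => ax.
  near=> n; rewrite /= in_itv/= ax/= -lerBlDl (@le_trans _ _ n%:R) ?ler_nat//.
  by near: n; exact: nbhs_infty_ger.
move: h1; under eq_fun do rewrite (Rintegral_FTC2 (F := F)) ?ltrDl//.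
move=> h1; apply: etrans (esym (cvg_lim (@Rhausdorff R) h1)) (cvg_lim (@Rhausdorff R) _).
apply: cvgB; last exact: cvg_cst.
move/cvg_pinftyP : Fl; apply.
apply/cvgryPge => M; near=> n.
rewrite -lerBlDl (@le_trans _ _ n%:R) ?ler_nat//.
by near: n; exact: nbhs_infty_ger.
Unshelve. all: by end_near. Qed.

Lemma Rintegral_FTC2T (f F : R -> R) (l l' : R) : continuous f ->
  mu.-integrable setT (EFin \o f) ->
  (forall x : R, is_derive x 1 F (f x)) ->
  F x @[x --> +oo] --> l -> F x @[x --> -oo] --> l' ->
  \int[mu]_x f x = l - l'.
Proof.
move=> cf intf dF Fl Fl'.
have nE : (n.+1%:R : R) @[n --> \oo] --> +oo.
  apply/cvgryPge => M; near=> n.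
  rewrite (@le_trans _ _ n%:R) ?ler_nat//.
  by near: n; exact: nbhs_infty_ger.
have h1 : \int[mu]_(x in `[- n.+1%:R, n.+1%:R]) f x @[n --> \oo] --> \int[mu]_x f x.
  apply: cvg_Rintegral_exhaustion => // x _.
  near=> n; rewrite /= in_itv/= -ler_norml.
  rewrite (@le_trans _ _ n%:R) ?ler_nat//.
  by near: n; exact: nbhs_infty_ger.
move: h1; under eq_fun do rewrite (Rintegral_FTC2 (F := F)) ?gt0_cp//.
move=> h1; apply: etrans (esym (cvg_lim (@Rhausdorff R) h1)) (cvg_lim (@Rhausdorff R) _).
apply: cvgB; first by move/cvg_pinftyP : Fl; exact.
by move/cvg_ninftyP : Fl'; apply; exact/cvgNrNy.
Unshelve. all: by end_near. Qed.

End FTC.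

(** * Gaussians *)

Section gaussian.
Context (R : realType).
Notation mu := (@lebesgue_measure R).

(** The normalization for which the Gaussian has mass one and is its own Fourier transform. *)
Definition gam (x : R) : R := expR (- pi * x ^+ 2).

Lemma gam_ge0 x : 0 <= gam x. Proof. exact: expR_ge0. Qed.

Lemma gamN x : gam (- x) = gam x. Proof. by rewrite /gam sqrrN. Qed.

Lemma integral_gaussian (k c : R) : 0 < k ->
  mu.-integrable setT (EFin \o (fun x => expR (- pi * k ^+ 2 * (x - c) ^+ 2))) /\
  \int[mu]_x expR (- pi * k ^+ 2 * (x - c) ^+ 2) = k^-1.
Proof.
(* With this standard deviation the normal density is [k * expR (- pi * k ^+ 2 * (x - c) ^+ 2)]. *)
move=> k0; pose s : R := (Num.sqrt (pi * 2) * k)^-1.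
have p0 : 0 < pi * 2 :> R by rewrite mulr_gt0 ?pi_gt0.
have s0 : s != 0 by rewrite invr_eq0 mulf_neq0 ?gt_eqF// sqrtr_gt0.
have s2 : s ^+ 2 = (pi * 2 * k ^+ 2)^-1.
  by rewrite exprVn exprMn sqr_sqrtr// ltW.
have E : (fun x : R => expR (- pi * k ^+ 2 * (x - c) ^+ 2)) =
  (fun x => k^-1 * normal_pdf c s x).
  apply/funext => x; rewrite /normal_pdf (negbTE s0) /normal_peak /normal_fun.
  have -> : s ^+ 2 * pi *+ 2 = (k^-1) ^+ 2.
    have /gt_eqF/negbT := pi_gt0 R; have /gt_eqF/negbT := k0.
    by rewrite s2 -mulr_natr; move: (pi : R) => P k0' P0; field; apply/andP.
  have ki0 : 0 <= k^-1 by rewrite invr_ge0 ltW.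
  rewrite sqrtr_sqr (ger0_norm ki0) invrK (mulKf (lt0r_neq0 k0)).
  congr (expR _).
  have /gt_eqF/negbT := pi_gt0 R; have /gt_eqF/negbT := k0.
  by rewrite s2 -mulr_natr; move: (pi : R) => P k0' P0; field; apply/andP.
have ig := integrable_normal_pdf c s.
rewrite E; split.
  have := integrableZl measurableT k^-1 ig.
  by apply: eq_integrable => // x _.
by rewrite RintegralZl// /Rintegral integral_normal_pdf /= mulr1.
Qed.

Lemma integrable_gam : mu.-integrable setT (EFin \o gam).
Proof.
have [+ _] := integral_gaussian 0 (@ltr01 R).
apply: eq_integrable => // x _ /=.
by rewrite /gam subr0 expr1n mulr1.
Qed.

Lemma Rintegral_gam : \int[mu]_x gam x = 1.
Proof.
have [_] := integral_gaussian 0 (@ltr01 R); rewrite invr1 => <-.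
by apply: eq_Rintegral => x _; rewrite /gam subr0 expr1n mulr1.
Qed.

Lemma integrable_expN_half_sqr (c : R) : mu.-integrable setT (EFin \o (fun x => expR (-
  ((x - c) ^+ 2 / 2)))).
Proof.
have k0 : 0 < (Num.sqrt (pi * 2))^-1 :> R by rewrite invr_gt0 sqrtr_gt0 mulr_gt0 ?pi_gt0.
have [+ _] := integral_gaussian c k0.
apply: eq_integrable => // x _ /=; congr (expR _)%:E.
rewrite exprVn sqr_sqrtr; last by rewrite ltW// mulr_gt0 ?pi_gt0.
have /gt_eqF/negbT := pi_gt0 R; move: (pi : R) => P P0; by field.
Qed.

(** Polynomial multiples of the Gaussian are closed under differentiation, and [Dpgam] is its action
    on the polynomial factor. The iterates of [Dpgam] at [1] are Hermite polynomials up to sign and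
    scaling. *)
Definition pgam (p : {poly R}) (x : R) := p.[x] * gam x.
Definition Dpgam (p : {poly R}) : {poly R} := p^`() - (2 * pi) *: 'X * p.

Lemma is_derive_gam (x : R) : is_derive x 1 gam (- (2 * pi) * x * gam x).
Proof.
rewrite /gam; apply: is_derive_eq.
by rewrite /GRing.scale /= mulr1; ring.
Qed.

Lemma is_derive_pgam p (x : R) : is_derive x 1 (pgam p) (pgam (Dpgam p) x).
Proof.
rewrite /Dpgam.
have dg := is_derive_gam x; have dp := is_derive_poly p x.
rewrite (_ : pgam p = horner p * gam)//; apply: is_derive_eq.
by rewrite /pgam !hornerE /GRing.scale /=; ring.
Qed.

(** Induction on the polynomial, with the hypothesis used at [e / 2]. The other half of the exponent
    absorbs one factor [x], since [|x| <= 1 + x^2 <= (1 + 2 / e) (1 + e / 2 x^2)]. *)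
Lemma poly_expR_bound (p : {poly R}) (e : R) : 0 < e ->
  exists2 C, 0 <= C & forall x, `|p.[x]| <= C * expR (e * x ^+ 2).
Proof.
elim/poly_ind: p e => [|p c IH] e e0.
  by exists 0 => // x; rewrite horner0 normr0 mul0r.
have e20 : 0 < e / 2 by rewrite divr_gt0.
have [C C0 HC] := IH _ e20.
exists (C * (1 + 2 / e) + `|c|).
  by rewrite addr_ge0// mulr_ge0// addr_ge0// divr_ge0// ltW.
move=> x; rewrite hornerMXaddC mulrDl (le_trans (ler_normD _ _))// lerD//; last first.
  by rewrite ler_peMr// -[leLHS]expR0 ler_expR mulr_ge0 ?sqr_ge0 ?(ltW e0).
have -> : e * x ^+ 2 = e / 2 * x ^+ 2 + e / 2 * x ^+ 2 by field.
rewrite expRD normrM; set b := expR _.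
have hx : `|x| <= (1 + 2 / e) * b.
  have h1 : 1 + e / 2 * x ^+ 2 <= b by exact: expR_ge1Dx.
  have h2 : `|x| <= 1 + x ^+ 2.
    by rewrite ler_norml; apply/andP; split; nra.
  apply: (le_trans h2); rewrite mulrC; apply: le_trans (ler_wpM2r _ h1); last first.
    by rewrite addr_ge0// divr_ge0// ltW.
  have -> : (1 + e / 2 * x ^+ 2) * (1 + 2 / e) = 1 + x ^+ 2 + (2 / e + e / 2 * x ^+ 2).
    by field; rewrite gt_eqF.
  rewrite lerDl addr_ge0 ?divr_ge0 ?(ltW e0)//.
  by rewrite mulr_ge0 ?sqr_ge0 ?(ltW e20).
apply: le_trans (ler_pM (normr_ge0 _) (normr_ge0 _) (HC x) hx) _.
by rewrite -/b le_eqVlt; apply/orP; left; apply/eqP; ring.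
Qed.

(** The polynomial costs a factor [expR (x ^+ 2)], and [pi >= 2] leaves [expR (- x ^+ 2)] of the
    Gaussian. *)
Lemma pgam_bound (p : {poly R}) : exists2 C, 0 <= C & forall x,
  `|pgam p x| <= C * expR (- x ^+ 2).
Proof.
have [C C0 HC] := poly_expR_bound p (@ltr01 R).
exists C => // x; rewrite /pgam normrM (ger0_norm (gam_ge0 _)).
apply: (le_trans (ler_wpM2r (gam_ge0 x) (HC x))).
rewrite -mulrA ler_wpM2l// /gam -expRD ler_expR mul1r.
have p2 : 2 <= pi :> R by exact: pi_ge2.
have := sqr_ge0 x; nra.
Qed.

Lemma continuous_pgam p : continuous (pgam p).
Proof.
move=> x; apply: differentiable_continuous; apply/derivable1_diffP.
by have [] := is_derive_pgam p x.
Qed.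

Lemma continuous_gam : continuous gam.
Proof.
move=> x; apply: differentiable_continuous; apply/derivable1_diffP.
by have [] := is_derive_gam x.
Qed.

Lemma measurable_gam : measurable_fun setT gam.
Proof. exact: continuous_measurable_fun continuous_gam. Qed.

Lemma measurable_pgam p : measurable_fun setT (pgam p).
Proof. exact: continuous_measurable_fun (@continuous_pgam p). Qed.

End gaussian.

(** * Differentiation under the integral sign *)

Section differentiation.
Context d (T : measurableType d) (R : realType) (mu : {measure set T -> \bar R}).

Lemma is_derive_Rintegral (f df : R -> T -> R) (G : T -> R) (a e : R) : 0 < e ->
  (forall x, mu.-integrable setT (EFin \o f x)) ->
  (forall (x : R) y, is_derive x 1 (f^~ y) (df x y)) ->
  mu.-integrable setT (EFin \o G) ->
  (forall x y, `|x - a| < e -> `|df x y| <= G y) ->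
  is_derive a 1 (fun x => \int[mu]_y f x y) (\int[mu]_y df a y).
Proof.
move=> e0 intf dfE intG dfG.
have Ia : `](a - e), (a + e)[%classic a by rewrite /= in_itv/= ltrBlDr ltrDl e0.
have dE x y : partial1of2 f x y = df x y.
  by rewrite partial1of2E; have [] := dfE x y.
have G0 y : 0 <= G y by rewrite (le_trans _ (dfG a y _))// subrr normr0.
have der x y : `](a - e), (a + e)[%classic x -> setT y -> derivable (f^~ y) x 1.
  by move=> _ _; have [] := dfE x y.
have Gub x y : `](a - e), (a + e)[%classic x -> setT y -> `|partial1of2 f x y| <= G y.
  rewrite /= in_itv/= => /andP[h1 h2] _; rewrite dE; apply: dfG.
  by rewrite ltr_norml; apply/andP; split; lra.
apply: DeriveDef.
  exact: (@derivable_under_integral _ _ _ mu f setT measurableT a _ _ Ia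
    (fun x _ => intf x) der G G0 intG Gub).
rewrite -derive1E (@differentiation_under_integral _ _ _ mu f setT measurableT a _ _ Ia
    (fun x _ => intf x) der G G0 intG Gub).
by apply: eq_Rintegral => y _; rewrite dE.
Qed.

End differentiation.

(** * Fourier transform of the Gaussian *)

Section fourier.
Context (R : realType).
Notation mu := (@lebesgue_measure R).

Lemma integrable_pgam (p : {poly R}) : mu.-integrable setT (EFin \o pgam p).
Proof.
have [C C0 HC] := pgam_bound p.
apply: integrable_le (integrable_scale C (integrable_expN_half_sqr (0 : R))).
  exact: measurable_pgam.
move=> x; rewrite (le_trans (HC x))// ler_wpM2l// ler_expR subr0.
by have := sqr_ge0 x; lra.
Qed.

Lemma cvg_gam_y : gam x @[x --> +oo] --> (0 : R).
Proof.
apply: (@squeeze_cvgr _ _ _ _ (cst 0) (@gauss_fun R)); last 2 first.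
- exact: cvg_cst.
- exact: cvg_gauss_fun.
apply: nearW => x; rewrite gam_ge0/= /gam /gauss_fun ler_expR.
by have := pi_ge2 R; have := sqr_ge0 x; nra.
Qed.

Lemma cvg_gam_Ny : gam x @[x --> -oo] --> (0 : R).
Proof.
apply/cvgNy_compNP; rewrite (_ : _ \o _ = @gam R); first exact: cvg_gam_y.
by apply/funext => x /=; rewrite gamN.
Qed.

Lemma cvg0_mul_bounded (F : set_system R) {FF : Filter F} (f g : R -> R) :
  f x @[x --> F] --> (0 : R) -> (forall x, `|g x| <= 1) ->
  f x * g x @[x --> F] --> (0 : R).
Proof.
move=> f0 g1; apply: norm_cvg0.
apply: (@squeeze_cvgr _ _ _ _ (cst 0) (fun x => `|f x|)).
- by apply: nearW => x; rewrite normr_ge0/= normrM ler_piMr.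
- exact: cvg_cst.
- by rewrite -[X in _ --> X](normr0 R); exact: cvg_norm.
Qed.

Lemma continuous_is_derive (f df : R -> R) : (forall x : R, is_derive x 1 f (df x)) ->
  continuous f.
Proof.
move=> h x; apply: differentiable_continuous; apply/derivable1_diffP.
by have [] := h x.
Qed.

Lemma is_derive_cosM (k x : R) : is_derive x 1 (fun x : R => cos (k * x)) (- (k * sin
  (k * x))).
Proof. by apply: is_derive_eq; rewrite /GRing.scale/=; ring. Qed.

Lemma is_derive_sinM (k x : R) : is_derive x 1 (fun x : R => sin (k * x)) (k * cos (k *
  x)).
Proof. by apply: is_derive_eq; rewrite /GRing.scale/=; ring. Qed.

Lemma continuous_cosM (k : R) : continuous (fun x : R => cos (k * x)).
Proof. exact: continuous_is_derive (is_derive_cosM k). Qed.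

Lemma continuous_sinM (k : R) : continuous (fun x : R => sin (k * x)).
Proof. exact: continuous_is_derive (is_derive_sinM k). Qed.

Lemma normr_cos_le1 (x : R) : `|cos x| <= 1.
Proof. by rewrite ler_norml cos_geN1 cos_le1. Qed.

Lemma normr_sin_le1 (x : R) : `|sin x| <= 1.
Proof. by rewrite ler_norml sin_geN1 sin_le1. Qed.

Lemma integrable_mul_cos (f : R -> R) (k : R) : mu.-integrable setT (EFin \o f) ->
  mu.-integrable setT (EFin \o (fun x => f x * cos (k * x))).
Proof.
apply: (@integrable_mulr_bounded _ _ _ _ _ _ 1); last by move=> x; exact: normr_cos_le1.
exact: continuous_measurable_fun (@continuous_cosM k).
Qed.

Lemma integrable_mul_sin (f : R -> R) (k : R) : mu.-integrable setT (EFin \o f) ->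
  mu.-integrable setT (EFin \o (fun x => f x * sin (k * x))).
Proof.
apply: (@integrable_mulr_bounded _ _ _ _ _ _ 1); last by move=> x; exact: normr_sin_le1.
exact: continuous_measurable_fun (@continuous_sinM k).
Qed.

Lemma fourier_sin_gam (c : R) : \int[mu]_x (gam x * sin (2 * pi * c * x)) = 0.
Proof.
have ig := integrable_mul_sin (2 * pi * c) (@integrable_gam R).
have [_ E] := Rintegral_opp ig.
have : \int[mu]_x (gam (- x) * sin (2 * pi * c * - x)) =
  - \int[mu]_x (gam x * sin (2 * pi * c * x)).
  rewrite -mulN1r -RintegralZl//; apply: eq_Rintegral => x _.
  by rewrite gamN mulrN sinN; ring.
by rewrite E; lra.
Qed.

(** Differentiating under the integral brings out [- 2 pi x * gam x], which is the derivative of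
    [gam]. Integration by parts then turns the sine back into a cosine. *)
Lemma fourier_cos_gam_derive (c : R) :
  is_derive c 1 (fun c => \int[mu]_x (gam x * cos (2 * pi * c * x)))
    (- (2 * pi * c) * \int[mu]_x (gam x * cos (2 * pi * c * x))).
Proof.
pose p : {poly R} := (2 * pi) *: 'X.
have pE x : p.[x] = 2 * pi * x by rewrite /p !hornerE.
have := @is_derive_Rintegral _ _ R mu (fun c x => gam x * cos (2 * pi * c * x))
  (fun c x => - pgam p x * sin (2 * pi * c * x)) (fun x => `|pgam p x|) c 1 ltr01.
have intp : mu.-integrable setT (EFin \o (fun x => `|pgam p x|)).
  exact: integrable_norm (integrable_pgam p).
have ints : mu.-integrable setT (EFin \o (fun x => - pgam p x * sin (2 * pi * c * x))).
  by apply: integrable_mul_sin; exact: integrable_opp (integrable_pgam p).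
have intc := integrable_mul_cos (2 * pi * c) (@integrable_gam R).
move=> /(_ _ _ intp); rewrite (_ : \int[mu]_y (- pgam p y * sin (2 * pi * c * y)) =
  - (2 * pi * c) * \int[mu]_x (gam x * cos (2 * pi * c * x))); last first.
  (* Integration by parts, as the fundamental theorem for [gam x * sin (2 pi c x)], which tends to
     zero at both ends. *)
  have := @Rintegral_FTC2T R (fun x => - pgam p x * sin (2 * pi * c * x) +
    2 * pi * c * (gam x * cos (2 * pi * c * x)))
     (fun x => gam x * sin (2 * pi * c * x)) 0 0.
  rewrite RintegralD//; last first.
    exact: integrable_scale.
  rewrite RintegralZl// => h; apply/eqP;
    rewrite mulNr -addr_eq0 -[X in _ == X](subrr 0); apply/eqP; apply: h.
  - move=> x; apply: cvgD; apply: cvgM.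
    + by apply: cvgN; exact: continuous_pgam.
    + exact: continuous_sinM.
    + exact: cvg_cst.
    + by apply: cvgM; [exact: continuous_gam|exact: continuous_cosM].
  - exact: integrable_add ints (integrable_scale _ intc).
  - move=> x; have dg := is_derive_gam x; have ds := is_derive_sinM (2 * pi * c) x.
    rewrite (_ : (fun x => _ * _) = @gam R * (fun x : R => sin (2 * pi * c * x)))//.
    apply: is_derive_eq; rewrite /pgam pE /GRing.scale/=; ring.
  - by apply: cvg0_mul_bounded; [exact: cvg_gam_y|move=> x; exact: normr_sin_le1].
  - by apply: cvg0_mul_bounded; [exact: cvg_gam_Ny|move=> x; exact: normr_sin_le1].
apply.
- by move=> c'; apply: integrable_mul_cos; exact: integrable_gam.
- move=> c' x; apply: is_derive_eq; rewrite /pgam pE /GRing.scale/=; ring.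
- move=> c' x _; rewrite normrM normrN ler_piMr//; exact: normr_sin_le1.
Qed.

(** The transform [F] solves [F' = - 2 pi c F], so [F c * expR (pi * c ^+ 2)] is constant, and [F 0]
    is the mass of the Gaussian. *)
Lemma fourier_cos_gam (c : R) : \int[mu]_x (gam x * cos (2 * pi * c * x)) = gam c.
Proof.
set F := fun c : R => \int[mu]_x (gam x * cos (2 * pi * c * x)).
have H : (F c) * expR (pi * c ^+ 2) = F 0 * expR (pi * 0 ^+ 2).
  apply: (is_derive_0_is_cst (f := fun c => (F c) * expR (pi * c ^+ 2))) => {}c.
  have dF := fourier_cos_gam_derive c.
  have -> : (fun c => (F c) * expR (pi * c ^+ 2)) =
    F * (fun c => expR (pi * c ^+ 2)) by [].
  apply: is_derive_eq; rewrite /GRing.scale/=/F; ring.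
have F0 : F 0 = 1.
  rewrite -(@Rintegral_gam R); apply: eq_Rintegral => x _.
  by rewrite mulr0 mul0r cos0 mulr1.
rewrite -/(F c) /gam mulNr expRN -[RHS]mul1r -F0; apply/eqP.
rewrite eq_sym -[eqbLHS]/(_ / _) eq_sym; rewrite -(mulr1 (F 0)) -expR0.
rewrite -[in X in _ == _ * expR X / _](mulr0 pi).
have -> : (0 : R) = 0 ^+ 2 by rewrite expr0n.
by rewrite [X in _ == F X * _ / _]expr0n/= -H mulfK// gt_eqF// expR_gt0.
Qed.

End fourier.

(** * Fourier transforms of one-sided exponentials *)

Section laplace.
Context (R : realType).
Notation mu := (@lebesgue_measure R).

Lemma integrable_itv (i : interval R) (f : R -> R) :
  mu.-integrable setT (EFin \o f) -> mu.-integrable [set` i] (EFin \o f).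
Proof.
exact: (@integrableS _ _ _ mu setT _ _ measurableT (measurable_itv _) (@subsetT _ _)).
Qed.

Lemma integrable_expN (k : R) : 0 < k ->
  mu.-integrable `[0, +oo[ (EFin \o (fun x => expR (- (k * x)))).
Proof.
move=> k0; have ie := integrable_scale k^-1 (integrable_exponential_pdf k0).
have := @integrableS _ _ _ mu setT `[0,
  +oo[%classic _ measurableT (measurable_itv _) (@subsetT _ _) ie.
apply: eq_integrable => // x; rewrite inE/= in_itv/= andbT => x0.
by rewrite exponential_pdfE// mulrA mulVf ?gt_eqF// mul1r mulNr.
Qed.

Lemma cvg_expN (k : R) : 0 < k -> expR (- (k * x)) @[x --> +oo] --> (0 : R).
Proof.
move=> k0; apply: (cvg_comp (fun x => k * x) (fun x => expR (- x)));
  last exact: cvgr_expR.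
by apply: gt0_cvgMry => //; exact: cvg_id.
Qed.

Lemma laplace_trig (k w c d : R) : 0 < k ->
  \int[mu]_(s in `[0, +oo[) (expR (- (k * s)) * (c * cos (w * s) + d * sin (w * s))) =
  (k * c + w * d) / (k ^+ 2 + w ^+ 2).
Proof.
move=> k0; have N0 : 0 < k ^+ 2 + w ^+ 2 by rewrite ltr_wpDr ?sqr_ge0// exprn_gt0.
(* A primitive of the integrand, from a linear system of size two for the coefficients of [cos] and
   [sin]. It vanishes at infinity, and its value at zero is minus the right-hand side. *)
pose F := (fun s : R => expR (- (k * s)) * ((w * c - k * d) / (k ^+ 2 +
  w ^+ 2) * sin (w * s) - (k * c + w * d) / (k ^+ 2 + w ^+ 2) * cos (w * s))).
pose f := (fun s : R => expR (- (k * s)) * (c * cos (w * s) + d * sin (w * s))).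
have dcs s := is_derive_cosM w s; have dsn s := is_derive_sinM w s.
have dF (s : R) : is_derive s 1 F (f s).
  rewrite /F; apply: is_derive_eq; rewrite /f /GRing.scale/=; field; by rewrite gt_eqF.
have cexp : continuous (fun s : R => expR (- (k * s))).
  by apply: (@continuous_is_derive R _ (fun s => - k * expR (- (k * s)))) => x;
    apply: is_derive_eq; rewrite /GRing.scale/=; ring.
have ctrig : continuous (fun s : R => c * cos (w * s) + d * sin (w * s)).
  move=> x; apply: cvgD; (apply: cvgM; [exact: cvg_cst|]).
    exact: continuous_cosM.
  exact: continuous_sinM.
have bdd A B : forall x : R, `|A * cos (w * x) + B * sin (w * x)| <= `|A| + `|B|.
  move=> x; rewrite (le_trans (ler_normD _ _))// !normrM lerD// ler_piMr//
    ?normr_cos_le1 ?normr_sin_le1//.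
have cf : continuous f by move=> x; apply: cvgM; [exact: cexp|exact: ctrig].
have intf : mu.-integrable `[0, +oo[ (EFin \o f).
  have := integrable_expN k0 => /integrableMl h; apply: h => //.
    apply: measurable_funTS; exact: continuous_measurable_fun.
  exists (`|c| + `|d|); split; first exact: num_real.
  by move=> M hM x _ /=; rewrite (le_trans (bdd _ _ _))// ltW.
rewrite (@Rintegral_FTC2y R f F 0 0)//.
  by rewrite /F mulr0 oppr0 expR0 mulr0 sin0 cos0; field; rewrite gt_eqF.
rewrite /F; set A := (_ / _); set B := (_ / _).
(* The trigonometric factor is normalized to absolute value at most one; the summand [1] keeps the
   divisor positive when [A = B = 0]. *)
have -> : (fun x : R => expR (- (k * x)) * (A * sin (w * x) - B * cos (w * x))) =
  (fun x => (`|B| + `|A| + 1) * (expR (- (k * x)) * ((- B * cos (w * x) +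
    A * sin (w * x)) / (`|B| + `|A| + 1)))).
  apply/funext => x; field.
  by rewrite gt_eqF// ltr_wpDl// addr_ge0.
rewrite -[X in _ --> X](mulr0 (`|B| + `|A| + 1)); apply: cvgM; first exact: cvg_cst.
apply: cvg0_mul_bounded; first exact: cvg_expN.
move=> x; rewrite normrM normfV ler_pdivrMr ?mul1r;
  last by rewrite normr_gt0 gt_eqF// ltr_wpDl// addr_ge0.
rewrite (le_trans (bdd _ _ _))// normrN [leRHS]ger0_norm ?lerDl//.
Qed.

(** The Fourier transform of [kern a] at [x] is [- i / (pi (x - i a))], for both
    signs of [a]; the value at [s = 0] is irrelevant. *)
Definition kern (a s : R) : R := (Num.sg a + Num.sg s) * expR (- (2 * pi * a * s)).

(** Reduces negative [a] to positive [a] by the reflection of [s]. *)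
Lemma kernN a s : kern a (- s) = - kern (- a) s.
Proof. by rewrite /kern !sgrN !mulrN !mulNr opprK; ring. Qed.

Lemma measurable_sgr : measurable_fun setT (@Num.sg R).
Proof.
apply: nondecreasing_measurable => // x y xy.
case: (sgrP x) xy => [->|x0|x0] xy; case: (sgrP y) => [y0|y0|y0] //; lra.
Qed.

Lemma normr_sgr_le1 (x : R) : `|Num.sg x| <= 1.
Proof. by rewrite normr_sg; case: (x != 0). Qed.

(** For positive [a] the factor [1 + sg s] is [2] where the exponential decays and [0] where it
    grows. With [g = 1] this gives integrability of [kern] itself. *)
Lemma kern_pos (a M : R) (g : R -> R) : 0 < a -> measurable_fun setT g ->
  (forall x, `|g x| <= M) ->
  mu.-integrable setT (EFin \o (fun s => kern a s * g s)) /\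
  \int[mu]_s (kern a s * g s) = 2 * \int[mu]_(s in `[0,
    +oo[) (expR (- (2 * pi * a * s)) * g s).
Proof.
move=> a0 mg gM.
have k0 : 0 < 2 * pi * a by rewrite !mulr_gt0 ?pi_gt0.
have kernE s : kern a s = (1 + Num.sg s) * expR (- (2 * pi * a * s)) by rewrite /kern
  gtr0_sg.
have iker : mu.-integrable setT (EFin \o (fun s => kern a s * g s)).
  have ie : mu.-integrable setT (EFin \o ((fun s => expR (- (2 * pi * a * s))) \_ `[0,
    +oo[)).
    by rewrite -restrict_EFin; apply: (@integrable_mkcond _ _ _ mu `[0,
      +oo[%classic (EFin \o (fun s => expR (- (2 * pi * a * s)))) (measurable_itv
        _)).1; exact: integrable_expN.
  have bs (s : R) : `|1 + Num.sg s| <= 2.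
    by rewrite (le_trans (ler_normD _ _))// normr1 (_ : 2 = 1 + 1)// lerD2l normr_sgr_le1.
  have mf : measurable_fun setT (fun s : R => (1 + Num.sg s) * g s).
    by apply: measurable_funM => //; apply: measurable_funD => //; exact: measurable_sgr.
  have := @integrable_mull_bounded _ _ _ mu _ _ (2 * M) mf _ ie.
  have h : forall x, `|(1 + Num.sg x) * g x| <= 2 * M.
    by move=> x; rewrite normrM ler_pM.
  move/(_ h); apply: eq_integrable => // s _ /=; congr _%:E.
  rewrite patchE; case: ifPn => [_|]; first by rewrite kernE; ring.
  rewrite notin_setE/= in_itv/= andbT => /negP; rewrite -ltNge => s0.
  by rewrite kernE ltr0_sg// subrr !mul0r.
split=> //.
have mk : measurable_fun setT (fun s : R => kern a s * g s) by exact: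
  integrable_measurable iker.
have me : measurable_fun setT (fun s : R => expR (- (2 * pi * a * s)) * g s).
  apply: measurable_funM => //; apply: measurableT_comp => //.
  by apply: measurable_funN; exact: measurable_funM.
have ie : mu.-integrable `[0, +oo[ (EFin \o (fun s => expR (- (2 * pi * a * s)) * g s)).
  have := integrable_expN k0 => /integrableMl h; apply: h => //.
    exact: measurable_funTS.
  exists M; split; first exact: num_real.
  by move=> N hN x _ /=; rewrite (le_trans (gM x))// ltW.
transitivity (\int[mu]_(s in `[0, +oo[) (kern a s * g s)).
  rewrite [RHS]Rintegral_mkcond; apply: eq_Rintegral => s _.
  rewrite patchE; case: ifPn => //; rewrite notin_setE/= in_itv/= andbT => /negP;
    rewrite -ltNge => s0.
  by rewrite kernE ltr0_sg// subrr !mul0r.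
(* Opening the interval removes [s = 0], where the factor is [1] instead of [2]. *)
rewrite -Rintegral_itv_obnd_cbnd; last exact: integrable_itv.
rewrite -[in RHS]Rintegral_itv_obnd_cbnd; last first.
  apply: (@integrableS _ _ _ mu `[0, +oo[%classic) => //.
  by move=> s /=; rewrite !in_itv/= !andbT => /ltW.
rewrite -RintegralZl//; last first.
  apply: (@integrableS _ _ _ mu `[0, +oo[%classic) => //.
  by move=> s /=; rewrite !in_itv/= !andbT => /ltW.
apply: eq_Rintegral => s; rewrite inE/= in_itv/= andbT => s0.
by rewrite kernE gtr0_sg// mulrA.
Qed.

Lemma measurable_trig (c d w : R) : measurable_fun setT (fun s : R => c * cos (w * s) +
  d * sin (w * s)).
Proof.
apply: continuous_measurable_fun => x; apply: cvgD; (apply: cvgM; [exact: cvg_cst|]).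
  exact: continuous_cosM.
exact: continuous_sinM.
Qed.

Lemma normr_trig_le (c d x : R) : `|c * cos x + d * sin x| <= `|c| + `|d|.
Proof.
by rewrite (le_trans (ler_normD _ _))// !normrM lerD// ler_piMr// ?normr_cos_le1
  ?normr_sin_le1.
Qed.

Lemma integrable_kern (a : R) : a != 0 -> mu.-integrable setT (EFin \o kern a).
Proof.
have pos b : 0 < b -> mu.-integrable setT (EFin \o kern b).
  move=> b0; have [+ _] := @kern_pos b 1 (cst 1) b0 (measurable_cst _) (fun=> eq_ind_r
    (fun x => x <= 1) (lexx 1) (normr1 R)).
  by apply: eq_integrable => // x _ /=; rewrite mulr1.
case: (ltgtP a 0) => // a0 _; last exact: pos.
have /pos : 0 < - a by rewrite oppr_gt0.
move/Rintegral_opp => [/integrable_opp + _]; apply: eq_integrable => // x _ /=.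
by rewrite kernN !opprK.
Qed.

Lemma integrable_kern_trig (a c d w : R) : a != 0 ->
  mu.-integrable setT (EFin \o (fun s => kern a s * (c * cos (w * s) + d * sin (w * s)))).
Proof.
move=> a0; apply: (@integrable_mulr_bounded _ _ _ _ _ _ (`|c| + `|d|));
  first exact: measurable_trig.
  by move=> s; exact: normr_trig_le.
exact: integrable_kern.
Qed.

Lemma fourier_kern (a x c d : R) : a != 0 ->
  \int[mu]_s (kern a s * (c * cos (2 * pi * x * s) + d * sin (2 * pi * x * s))) =
  (c * a + d * x) / (pi * (a ^+ 2 + x ^+ 2)).
Proof.
have p0 : (pi : R) != 0 by rewrite gt_eqF ?pi_gt0.
have pos b e : 0 < b -> \int[mu]_s (kern b s * (c * cos (2 * pi * x * s) +
  e * sin (2 * pi * x * s))) =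
  (c * b + e * x) / (pi * (b ^+ 2 + x ^+ 2)).
  move=> b0; have [_ ->] := kern_pos b0 (measurable_trig c e (2 * pi * x)) (fun s =>
    normr_trig_le c e (2 * pi * x * s)).
  rewrite laplace_trig ?mulr_gt0 ?pi_gt0//.
  have N0 : b ^+ 2 + x ^+ 2 != 0 by rewrite gt_eqF// ltr_wpDr ?sqr_ge0// exprn_gt0.
  rewrite (_ : (2 * pi * b) ^+ 2 + (2 * pi * x) ^+ 2 =
    (2 * pi) ^+ 2 * (b ^+ 2 + x ^+ 2)); last by ring.
  by move: p0 N0; set N := _ + _; move: (pi : R) => P P0 N0; field; rewrite P0 N0.
case: (ltgtP a 0) => // a0 _; last exact: pos.
have b0 : 0 < - a by rewrite oppr_gt0.
have na : - a != 0 by rewrite gt_eqF.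
(* The reflection of [s] changes the sign of the sine, hence [- d]; the global sign comes from
   [kernN]. *)
have := pos _ (- d) b0; rewrite sqrrN => h.
transitivity (- ((c * - a + - d * x) / (pi * (a ^+ 2 + x ^+ 2))));
  last by rewrite -mulNr; congr (_ / _); ring.
rewrite -h -mulN1r -RintegralZl//; last first.
  exact: integrable_kern_trig.
have ik : mu.-integrable setT (EFin \o (fun s => kern a s * (c * cos (2 * pi * x * s) +
  d * sin (2 * pi * x * s)))).
  by apply: integrable_kern_trig; rewrite lt_eqF.
have [_ <-] := Rintegral_opp ik; apply: eq_Rintegral => s _.
by rewrite kernN mulrN cosN sinN; ring.
Qed.

End laplace.

(** * The error function *)

Section error_function.
Context (R : realType).
Notation mu := (@lebesgue_measure R).

Lemma Rintegral_split (f : R -> R) (x : R) : mu.-integrable setT (EFin \o f) ->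
  \int[mu]_y f y = \int[mu]_(y in `]-oo, x]) f y + \int[mu]_(y in `]x, +oo[) f y.
Proof.
move=> intf; rewrite -Rintegral_setU//.
- congr (Rintegral _ _ _); apply/seteqP; split=> y //= _; rewrite !in_itv/= andbT.
  by case: (lerP y x); [left|right].
- rewrite (_ : _ `|` _ = setT)//; apply/seteqP; split=> y //= _; rewrite !in_itv/= andbT.
  by case: (lerP y x); [left|right].
- apply/disj_setPS => y [] /=; rewrite !in_itv/= andbT => h1 h2.
  by have := le_lt_trans h1 h2; rewrite ltxx.
Qed.

Lemma is_derive_Rintegral_Ny (f : R -> R) (x : R) : continuous f ->
  mu.-integrable setT (EFin \o f) ->
  is_derive x 1 (fun x => \int[mu]_(y in `]-oo, x]) f y) (f x).
Proof.
move=> cf intf.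
have ltx : x < x + 1 by rewrite ltrDl.
have := @continuous_FTC1 R f -oo%O x (x + 1) ltx (integrable_itv _ intf).
rewrite ltNyr => /(_ isT (cf x))[h1 h2].
by apply: DeriveDef; [exact: h1|rewrite -derive1E; exact: h2].
Qed.

(** This is [erf (sqrt pi * x)]. The integral from minus infinity is differentiated directly;
    oddness becomes visible only through the form in [gerf_conv]. *)
Definition gerf (x : R) : R := 2 * \int[mu]_(y in `]-oo, x]) gam y - 1.

Lemma is_derive_gerf (x : R) : is_derive x 1 gerf (2 * gam x).
Proof.
have d := is_derive_Rintegral_Ny x (@continuous_gam R) (@integrable_gam R).
by apply: is_derive_eq; rewrite /GRing.scale/=; ring.
Qed.

Lemma continuous_gerf : continuous gerf.
Proof. exact: continuous_is_derive is_derive_gerf. Qed.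

Lemma measurable_gerf : measurable_fun setT gerf.
Proof. exact: continuous_measurable_fun continuous_gerf. Qed.

Lemma integrable_gam_sub (x : R) : mu.-integrable setT (EFin \o (fun v => gam (x - v))).
Proof.
have [+ _] := Rintegral_transl (- x) (@integrable_gam R).
by apply: eq_integrable => // v _ /=; rewrite -gamN opprB.
Qed.

Lemma Rintegral_gam_sub (x : R) : \int[mu]_v gam (x - v) = 1.
Proof.
have [_ <-] : _ /\ _ = 1 := conj I (@Rintegral_gam R).
have [_ <-] := Rintegral_transl (- x) (@integrable_gam R).
by apply: eq_Rintegral => v _; rewrite -gamN opprB.
Qed.

Lemma measurable_sgrD (k c : R) : measurable_fun setT (fun v : R => Num.sg (k * v + c)).
Proof.
apply: (measurableT_comp (@measurable_sgr R)).
by apply: measurable_funD => //; exact: measurable_funM.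
Qed.

Lemma integrable_mul_sg (f : R -> R) (k c : R) : mu.-integrable setT (EFin \o f) ->
  mu.-integrable setT (EFin \o (fun v => f v * Num.sg (k * v + c))).
Proof.
apply: (@integrable_mulr_bounded _ _ _ _ _ _ 1); first exact: measurable_sgrD.
by move=> v; exact: normr_sgr_le1.
Qed.

Lemma gerfE (x : R) : \int[mu]_v (gam v * Num.sg (x - v)) = gerf x.
Proof.
have ih : mu.-integrable setT (EFin \o (fun v => gam v * Num.sg (x - v))).
  have := integrable_mul_sg (- 1) x (@integrable_gam R);
    apply: eq_integrable => // v _ /=.
  by rewrite mulN1r addrC.
have mh := integrable_measurable ih.
have := @Rintegral_gam R; rewrite (Rintegral_split x (@integrable_gam R)).
rewrite (Rintegral_split x)// /gerf.
(* Opening the left half-lines drops [v = x], where the sign is zero. *)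
rewrite -(Rintegral_itv_bndo_bndc (a := -oo%O));
  last exact: integrable_itv (@integrable_gam R).
rewrite -(Rintegral_itv_bndo_bndc (a := -oo%O)); last exact: integrable_itv.
have -> : \int[mu]_(v in `]-oo, x[) (gam v * Num.sg (x - v)) = \int[mu]_(v in `]-oo,
  x[) gam v.
  apply: eq_Rintegral => v; rewrite inE/= in_itv/= => vx.
  by rewrite gtr0_sg ?mulr1// subr_gt0.
have -> : \int[mu]_(v in `]x, +oo[) (gam v * Num.sg (x - v)) = - \int[mu]_(v in `]x,
  +oo[) gam v.
  rewrite -mulN1r -RintegralZl//; last exact: integrable_itv (@integrable_gam R).
  apply: eq_Rintegral => v; rewrite inE/= in_itv/= andbT => xv.
  by rewrite ltr0_sg ?subr_lt0//; ring.
lra.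
Qed.

(** The heat evolution of [sg] on the line, obtained from [gerfE] by the substitution
    [v -> x - v]. *)
Lemma gerf_conv (x : R) : \int[mu]_v (gam (x - v) * Num.sg v) = gerf x.
Proof.
rewrite -gerfE.
have ih : mu.-integrable setT (EFin \o (fun v => gam v * Num.sg (x - v))).
  have := integrable_mul_sg (- 1) x (@integrable_gam R);
    apply: eq_integrable => // v _ /=.
  by rewrite mulN1r addrC.
have [i1 <-] := Rintegral_opp ih.
have [_ <-] := Rintegral_transl (- x) i1.
by apply: eq_Rintegral => v _; rewrite opprD opprK addrC; congr (_ * Num.sg _); ring.
Qed.

Lemma gerfN (x : R) : gerf (- x) = - gerf x.
Proof.
rewrite -!gerf_conv.
have ih y : mu.-integrable setT (EFin \o (fun v => gam (y - v) * Num.sg v)).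
  have := integrable_mul_sg 1 0 (integrable_gam_sub y); apply: eq_integrable => // v _ /=.
  by rewrite mul1r addr0.
have [_ <-] := Rintegral_opp (ih (- x)).
rewrite -[RHS]mulN1r -RintegralZl//; apply: eq_Rintegral => v _.
by rewrite -gamN sgrN (_ : - (- x - - v) = x - v); ring.
Qed.

Lemma gerf_le1 (x : R) : `|gerf x| <= 1.
Proof.
rewrite -gerfE -[leRHS](@Rintegral_gam R).
have ih : mu.-integrable setT (EFin \o (fun v => gam v * Num.sg (x - v))).
  have := integrable_mul_sg (- 1) x (@integrable_gam R);
    apply: eq_integrable => // v _ /=.
  by rewrite mulN1r addrC.
rewrite (le_trans (le_normr_Rintegral _ ih))// le_Rintegral//.
- exact: integrable_norm ih.
- exact: integrable_gam.
- by move=> v _; rewrite normrM (ger0_norm (gam_ge0 _)) ler_piMr ?gam_ge0// normr_sgr_le1.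
Qed.

(** Both sides have derivative [2 * gam x], and both vanish at zero: the left one by oddness, the
    right one by the half-line Gaussian integral. *)
Lemma gerf_erfc (x : R) : gerf x = 1 - erfc (x * Num.sqrt pi).
Proof.
have sp0 : 0 < Num.sqrt pi :> R by rewrite sqrtr_gt0 pi_gt0.
have sp2 : Num.sqrt pi ^+ 2 = pi :> R by rewrite sqr_sqrtr// pi_ge0.
(* The upper tail is rewritten through the lower one, whose derivative in the endpoint is
   available. *)
have erfcE y : erfc y = 2 / Num.sqrt pi * (Num.sqrt pi - \int[mu]_(t in `]-oo,
  y]) gauss_fun t).
  rewrite /erfc; congr (_ * _).
  have -> : Num.sqrt pi = \int[mu]_t gauss_fun t by rewrite /Rintegral integralT_gauss.
  rewrite (Rintegral_split y (@integrableT_gauss R)) addrAC subrr add0r.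
  by rewrite Rintegral_itv_obnd_cbnd//; exact: integrable_itv (@integrableT_gauss R).
have derfc (y : R) : is_derive y 1 (fun y : R => erfc (y * Num.sqrt pi)) (- (2 * gam y)).
  rewrite (_ : (fun y => _) = (fun y => 2 / Num.sqrt pi * (Num.sqrt pi - \int[mu]_(t in
    `]-oo, y * Num.sqrt pi]) gauss_fun t))); last first.
    by apply/funext => z; rewrite erfcE.
  have dg := is_derive_Rintegral_Ny (y * Num.sqrt pi) (@continuous_gauss_fun R)
    (@integrableT_gauss R).
  have dc : is_derive y 1 (fun y : R => \int[mu]_(t in `]-oo,
    y * Num.sqrt pi]) gauss_fun t) (gauss_fun (y * Num.sqrt pi) * Num.sqrt pi).
    have dl : is_derive y 1 (fun y : R => y * Num.sqrt pi) (Num.sqrt pi).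
      by apply: is_derive_eq; rewrite /GRing.scale/=; ring.
    exact: (@is_derive1_comp R (fun y => \int[mu]_(t in `]-oo,
      y]) gauss_fun t) (fun y => y * Num.sqrt pi) y _ _ dg dl).
  apply: is_derive_eq; rewrite /GRing.scale/= /gauss_fun /gam.
  have -> : - (y * Num.sqrt pi) ^+ 2 = - pi * y ^+ 2 by rewrite exprMn sp2; ring.
  by field; rewrite gt_eqF.
have H : gerf x + erfc (x * Num.sqrt pi) = gerf 0 + erfc (0 * Num.sqrt pi).
  apply: (is_derive_0_is_cst (f := fun x => gerf x + erfc (x * Num.sqrt pi))) => y.
  have d1 := is_derive_gerf y; have d2 := derfc y.
  by apply: is_derive_eq; rewrite subrr.
have g0 : gerf 0 = 0 by have := gerfN 0; rewrite oppr0; lra.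
have e0 : erfc (0 * Num.sqrt pi) = 1 :> R.
  rewrite mul0r /erfc /Rintegral integral0y_gauss /=; field; by rewrite gt_eqF.
by move: H; rewrite g0 e0; lra.
Qed.

(** Separates the smooth part of [M1] from its jump, so that the terms of [E2] can cancel one kind
    at a time. *)
Lemma M1E (u : R) : M1 u = gerf u - Num.sg u.
Proof.
rewrite /M1; case: (ltrgt0P u) => [u0|u0|->].
- by rewrite gtr0_sg// gerf_erfc; ring.
- by rewrite ltr0_sg// -[in RHS](opprK u) gerfN gerf_erfc; ring.
- have := gerfN 0; rewrite oppr0 sgr0; lra.
Qed.

End error_function.

(** * Smoothness of Gaussian averages *)

Section gaussian_convolution.
Context (R : realType).
Notation mu := (@lebesgue_measure R).

(** From [(v - a)^2 <= 2 (x - a)^2 + 2 (x - v)^2] and [(x - a)^2 <= 1]: hence half of the exponent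
    and the factor [expR 1]. The bound is uniform in [x] near [a], as domination of a derivative
    requires. *)
Lemma pgam_shift_bound (p : {poly R}) : exists2 C, 0 <= C &
  forall a x v, `|x - a| < 1 -> `|pgam p (x - v)| <= C * expR (- ((v - a) ^+ 2 / 2)).
Proof.
have [C C0 HC] := pgam_bound p; exists (C * expR 1); first by rewrite mulr_ge0 ?expR_ge0.
move=> a x v; rewrite ltr_norml => /andP[h1 h2].
rewrite (le_trans (HC _))// -mulrA ler_wpM2l// -expRD ler_expR.
have t2 : (x - a) ^+ 2 <= 1 by nra.
by have := sqr_ge0 ((x - a) + (x - v)); nra.
Qed.

Variable alpha : R.

(** With [p = 1] and [h = gerf] this is the plane Gaussian average of
    [w v2 * sg (v1 + alpha v2)], after integration over [v1]. *)
Definition gconv (w : R -> R) (p : {poly R}) (h : R -> R) (x y : R) : R :=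
  \int[mu]_v (pgam p (y - v) * (w v * h (x + alpha * v))).

Variable w : R -> R.
Hypothesis mw : measurable_fun setT w.
Hypothesis w1 : forall v, `|w v| <= 1.

Lemma integrable_gconv (p : {poly R}) (h : R -> R) (B x y : R) :
  continuous h -> (forall z, `|h z| <= B) ->
  mu.-integrable setT (EFin \o (fun v => pgam p (y - v) * (w v * h (x + alpha * v)))).
Proof.
move=> ch hB.
apply: (@integrable_mulr_bounded _ _ _ _ _ _ (1 * B)).
- apply: measurable_funM => //; apply: measurableT_comp.
    exact: continuous_measurable_fun.
  by apply: measurable_funD => //; exact: measurable_funM.
- by move=> v; rewrite normrM ler_pM.
- have [+ _] := Rintegral_opp (integrable_pgam p).
  move=> /(Rintegral_transl (- y))[+ _]; apply: eq_integrable => // v _ /=.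
  by rewrite opprD opprK addrC.
Qed.

(** The variable [y] enters only through the Gaussian factor, as [x] enters only through [h]; the
    weight [w], a sign later on, is never differentiated. *)
Lemma gconv_derive_y (p : {poly R}) (h : R -> R) (B x y : R) :
  continuous h -> (forall z, `|h z| <= B) ->
  is_derive y 1 (gconv w p h x) (gconv w (Dpgam p) h x y).
Proof.
move=> ch hB; have B0 : 0 <= B by exact: le_trans (hB 0).
have [C C0 HC] := pgam_shift_bound (Dpgam p).
apply: (@is_derive_Rintegral _ _ R mu (fun y v => pgam p (y - v) * (w v * h (x +
  alpha * v)))
  (fun y v => pgam (Dpgam p) (y - v) * (w v * h (x + alpha * v)))
  (fun v => C * B * expR (- ((v - y) ^+ 2 / 2))) y 1 ltr01).
- by move=> z; exact: integrable_gconv hB.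
- move=> z v; have d1 : is_derive z 1 (fun z => pgam p (z - v)) (pgam (Dpgam p) (z - v)).
    have dl : is_derive z 1 (fun z : R => z - v) 1.
      by apply: is_derive_eq; rewrite subr0.
    have := @is_derive1_comp R (pgam p) (fun z => z - v) z _ _ (is_derive_pgam p (z -
      v)) dl.
    by rewrite mulr1.
  by apply: is_derive_eq; rewrite /GRing.scale/=; ring.
- exact: integrable_scale (integrable_expN_half_sqr y).
- move=> z v zy; rewrite normrM mulrAC ler_pM ?HC//.
  by rewrite normrM -[leRHS]mul1r ler_pM.
Qed.

Lemma gconv_derive_x (p : {poly R}) (h dh : R -> R) (B x y : R) :
  (forall z : R, is_derive z 1 h (dh z)) -> continuous dh ->
  (forall z, `|h z| <= B) -> (forall z, `|dh z| <= B) ->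
  is_derive x 1 (gconv w p h ^~ y) (gconv w p dh x y).
Proof.
move=> hd cdh hB dhB; have B0 : 0 <= B by exact: le_trans (hB 0).
have ch : continuous h := continuous_is_derive hd.
have [C C0 HC] := pgam_shift_bound p.
apply: (@is_derive_Rintegral _ _ R mu (fun x v => pgam p (y - v) * (w v * h (x +
  alpha * v)))
  (fun x v => pgam p (y - v) * (w v * dh (x + alpha * v)))
  (fun v => C * B * expR (- ((v - y) ^+ 2 / 2))) x 1 ltr01).
- by move=> z; exact: integrable_gconv hB.
- move=> z v; have d1 : is_derive z 1 (fun z => h (z + alpha * v)) (dh (z + alpha * v)).
    have dl : is_derive z 1 (fun z : R => z + alpha * v) 1.
      by apply: is_derive_eq; rewrite addr0.
    have := @is_derive1_comp R h (fun z => z + alpha * v) z _ _ (hd (z + alpha * v)) dl.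
    by rewrite mulr1.
  by apply: is_derive_eq; rewrite /GRing.scale/=; ring.
- exact: integrable_scale (integrable_expN_half_sqr y).
- move=> z v _; rewrite normrM mulrAC ler_pM ?HC ?subrr ?normr0//.
  by rewrite normrM -[leRHS]mul1r ler_pM.
Qed.

(** The dominating function is a translate by [y] of a fixed Gaussian, so its integral does not
    depend on [y]. *)
Lemma gconv_bound (p : {poly R}) (h : R -> R) (B : R) :
  continuous h -> (forall z, `|h z| <= B) ->
  exists M, forall x y, `|gconv w p h x y| <= M.
Proof.
move=> ch hB; have B0 : 0 <= B by exact: le_trans (hB 0).
have [C C0 HC] := pgam_shift_bound p.
exists (C * B * \int[mu]_v expR (- ((v - 0) ^+ 2 / 2))) => x y.
have ig := integrable_gconv p x y ch hB.
have [_ /= <-] := Rintegral_transl (- y) (integrable_expN_half_sqr (0 : R)).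
have ih := integrable_expN_half_sqr y.
rewrite -RintegralZl//; last first.
  by apply: eq_integrable ih => // v _ /=; rewrite subr0.
rewrite (le_trans (le_normr_Rintegral _ ig))// le_Rintegral//.
- exact: integrable_norm ig.
- have := integrable_scale (C * B) ih.
  by apply: eq_integrable => // v _ /=; rewrite subr0.
move=> v _; rewrite subr0 normrM mulrAC ler_pM ?HC ?subrr ?normr0//.
by rewrite normrM -[leRHS]mul1r ler_pM.
Qed.

End gaussian_convolution.

(** * Gaussian averages of the error function *)

Section convolution_gerf.
Context (R : realType).
Notation mu := (@lebesgue_measure R).

Lemma pgam1 : pgam 1 = @gam R.
Proof. by apply/funext => x; rewrite /pgam hornerC mul1r. Qed.

(** Both sides have the same derivative in [x] and vanish at [x = - alpha y]. *)
Lemma gconv_gerf (alpha x y : R) :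
  \int[mu]_v (gam (y - v) * gerf (x + alpha * v)) =
  gerf ((x + alpha * y) / Num.sqrt (1 + alpha ^+ 2)).
Proof.
set k := Num.sqrt _.
have a2 : 0 < 1 + alpha ^+ 2 by rewrite ltr_wpDr ?sqr_ge0.
have k0 : 0 < k by rewrite sqrtr_gt0.
have k2 : k ^+ 2 = 1 + alpha ^+ 2 by rewrite sqr_sqrtr// ltW.
have gE : (fun x => \int[mu]_v (gam (y - v) * gerf (x + alpha * v))) =
  (gconv alpha (cst 1) 1 (@gerf R))^~ y.
  by apply/funext => z; apply: eq_Rintegral => v _; rewrite pgam1 mul1r.
(* Completing the square in [v]: [(y - v)^2 + (z + alpha v)^2 = k^2 (v - (y - alpha z) / k^2)^2 + (z
   + alpha y)^2 / k^2]. *)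
have mono (z : R) : \int[mu]_v (gam (y - v) * (2 * gam (z + alpha * v))) =
  2 * gam ((z + alpha * y) / k) / k.
  have [i1 i2] := integral_gaussian ((y - alpha * z) / k ^+ 2) k0.
  rewrite -[X in _ = _ * X]i2 -RintegralZl//; apply: eq_Rintegral => v _.
  rewrite /gam mulrCA -[RHS]mulrA -!expRD; congr (_ * expR _).
  rewrite !exprMn !exprVn k2; field.
  by rewrite gt_eqF.
have gle (z : R) : `|2 * gam z| <= 2.
  rewrite normrM (ger0_norm (gam_ge0 _)) ger0_norm// ler_piMr// -expR0 ler_expR.
  by rewrite mulNr oppr_le0 mulr_ge0 ?pi_ge0 ?sqr_ge0.
have dL (z : R) : is_derive z 1 (fun x => \int[mu]_v (gam (y - v) * gerf (x +
  alpha * v))) (2 * gam ((z + alpha * y) / k) / k).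
  rewrite gE -mono.
  have -> : \int[mu]_v (gam (y - v) * (2 * gam (z + alpha * v))) =
    gconv alpha (cst 1) 1 (fun z => 2 * gam z) z y.
    by apply: eq_Rintegral => v _; rewrite pgam1 mul1r.
  apply: (@gconv_derive_x R alpha (cst 1) _ _ 1 (@gerf R) (fun z => 2 * gam z) 2) => //.
  - by move=> v; rewrite normr1.
  - exact: is_derive_gerf.
  - by move=> v; apply: cvgM; [exact: cvg_cst|exact: continuous_gam].
  - by move=> v; rewrite (le_trans (gerf_le1 v))// ler1n.
have dR (z : R) : is_derive z 1 (fun x => gerf ((x + alpha * y) / k)) (2 * gam ((z +
  alpha * y) / k) / k).
  have dl : is_derive z 1 (fun z : R => (z + alpha * y) / k) k^-1.
    by apply: is_derive_eq; rewrite /GRing.scale/=; ring.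
  exact: (@is_derive1_comp R (@gerf R) (fun z => (z +
    alpha * y) / k) z _ _ (is_derive_gerf _) dl).
pose D x := \int[mu]_v (gam (y - v) * gerf (x + alpha * v)) - gerf ((x + alpha * y) / k).
have : D x = D (- (alpha * y)).
  apply: is_derive_0_is_cst => z.
  have d1 := dL z; have d2 := dR z.
  by rewrite /D; apply: is_derive_eq; rewrite subrr.
have gerf0 : gerf 0 = 0 :> R by have := gerfN (0 : R); rewrite oppr0; lra.
rewrite {2}/D addNr mul0r gerf0 subr0.
(* At [x = - alpha y] the substitution [v -> y - v] leaves this odd integrand. *)
have iy : mu.-integrable setT (EFin \o (fun v => gam v * gerf (- alpha * v))).
  apply: (@integrable_mulr_bounded _ _ _ _ _ _ 1); last exact: integrable_gam.
    by apply: measurableT_comp; [exact: measurable_gerf|exact: measurable_funM].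
  by move=> v; exact: gerf_le1.
have [i2 E2] := Rintegral_opp iy; have [_ E3] := Rintegral_transl (- y) i2.
have -> : \int[mu]_v (gam (y - v) * gerf (- (alpha * y) + alpha * v)) =
  \int[mu]_v (gam v * gerf (- alpha * v)).
  rewrite -E2 -E3; apply: eq_Rintegral => v _.
  by congr (gam _ * gerf _); ring.
have : \int[mu]_v (gam (- v) * gerf (- alpha * - v)) =
  - \int[mu]_v (gam v * gerf (- alpha * v)).
  transitivity (\int[mu]_v (-1 * (gam v * gerf (- alpha * v)))).
    by apply: eq_Rintegral => v _; rewrite gamN mulrN gerfN mulrN mulN1r.
  by rewrite (RintegralZl (-1) measurableT iy) mulN1r.
move/eqP; rewrite E2 -addr_eq0 -mulr2n mulrn_eq0/= => /eqP -> /eqP.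
by rewrite /D subr_eq0 => /eqP.
Qed.

End convolution_gerf.

(** * Joint smoothness in two variables *)

Section smoothness.
Context (R : realType).
Notation mu := (@lebesgue_measure R).

Lemma lipschitz_derive (g dg : R -> R) (M : R) :
  (forall x : R, is_derive x 1 g (dg x)) -> (forall x, `|dg x| <= M) ->
  forall x y, `|g x - g y| <= M * `|x - y|.
Proof.
move=> dgE dgM.
have cg := continuous_is_derive dgE.
have lt x y : x < y -> `|g y - g x| <= M * `|y - x|.
  move=> xy; have [c _ ->] := @MVT R g dg x y xy (fun z _ => dgE z)
    (continuous_subspaceT cg).
  by rewrite normrM ler_wpM2r.
move=> x y; case: (ltgtP x y) => [xy|xy|->]; last by rewrite !subrr !normr0 mulr0.
  by rewrite distrC (distrC x); exact: lt.
exact: lt.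
Qed.

(** Moving parallel to one axis and then to the other, the mean value theorem makes [f]
    Lipschitz. *)
Lemma continuous_bounded_partials (f d1 d2 : R -> R -> R) (M : R) :
  (forall x y : R, is_derive x 1 (f^~ y) (d1 x y)) ->
  (forall x y : R, is_derive y 1 (f x) (d2 x y)) ->
  (forall x y, `|d1 x y| <= M) -> (forall x y, `|d2 x y| <= M) ->
  continuous (fun u : R * R => f u.1 u.2).
Proof.
move=> h1 h2 b1 b2 [a b]; apply/subr_cvg0; apply: norm_cvg0.
apply: (@squeeze_cvgr _ _ _ _ (cst 0) (fun u : R * R => M * (`|u.1 - a| + `|u.2 - b|))).
- apply: nearW => -[x y] /=; rewrite normr_ge0/=.
  have -> : f x y - f a b = (f x y - f a y) + (f a y - f a b) by ring.
  rewrite (le_trans (ler_normD _ _))// mulrDr lerD//.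
    exact: (lipschitz_derive (h1^~ y) (b1^~ y)).
  exact: (lipschitz_derive (h2 a) (b2 a)).
- exact: cvg_cst.
- rewrite -[X in _ --> X](mulr0 M); apply: cvgM; first exact: cvg_cst.
  rewrite -[X in _ --> X](addr0 0) /=; apply: cvgD.
    rewrite -[X in _ --> X](normr0 R) -(subrr a); apply: cvg_norm; apply: cvgB;
      last exact: cvg_cst.
    exact: cvg_fst.
  rewrite -[X in _ --> X](normr0 R) -(subrr b); apply: cvg_norm; apply: cvgB;
    last exact: cvg_cst.
  exact: cvg_snd.
Qed.

Lemma is_derive_fst (f : R * R -> R) (x y l : R) :
  is_derive x 1 (fun x => f (x, y)) l -> is_derive (x, y) (1, 0) f l.
Proof.
move=> [d e]; have E : (fun h : R => h^-1 *: (f (h *: ((1, 0) : R * R) + (x,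
  y)) - f (x, y))) =
  (fun h : R => h^-1 *: (f (h *: (1 : R) + x, y) - f (x, y))).
  by apply/funext => h; rewrite -[h *: (1, 0) + _]/(h *: (1 : R) + x,
    h *: (0 : R) + y) scaler0 add0r.
by apply: DeriveDef; [rewrite /derivable E|rewrite /derive E].
Qed.

Lemma is_derive_snd (f : R * R -> R) (x y l : R) :
  is_derive y 1 (fun y => f (x, y)) l -> is_derive (x, y) (0, 1) f l.
Proof.
move=> [d e]; have E : (fun h : R => h^-1 *: (f (h *: ((0, 1) : R * R) + (x,
  y)) - f (x, y))) =
  (fun h : R => h^-1 *: (f (x, h *: (1 : R) + y) - f (x, y))).
  by apply/funext => h; rewrite -[h *: (0, 1) + _]/(h *: (0 : R) + x,
    h *: (1 : R) + y) scaler0 add0r.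
by apply: DeriveDef; [rewrite /derivable E|rewrite /derive E].
Qed.

(** The partial derivatives of a member are members again, so boundedness of all members bounds all
    partials, and continuity follows at every order. *)
Lemma Ck_family (I : Type) (f : I -> R -> R -> R) (i1 i2 : I -> I) :
  (forall i (x y : R), is_derive x 1 (f i ^~ y) (f (i1 i) x y)) ->
  (forall i (x y : R), is_derive y 1 (f i x) (f (i2 i) x y)) ->
  (forall i, exists M, forall x y, `|f i x y| <= M) ->
  forall n i, Ck n (fun u : R * R => f i u.1 u.2).
Proof.
move=> h1 h2 hM; have cont i : continuous (fun u : R * R => f i u.1 u.2).
  have [M1 HM1] := hM (i1 i); have [M2 HM2] := hM (i2 i).
  apply: (@continuous_bounded_partials _ (f (i1 i)) (f (i2 i)) (Num.max M1 M2)) => // x y.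
    by rewrite le_max HM1.
  by rewrite le_max HM2 orbT.
elim=> [|n IH] i /=; first exact: cont.
have D1 x y := is_derive_fst (f := fun u => f i u.1 u.2) (h1 i x y).
have D2 x y := is_derive_snd (f := fun u => f i u.1 u.2) (h2 i x y).
split.
- exact: cont.
- by move=> [x y]; case: (D1 x y) => d1 _; case: (D2 x y) => d2 _; split;
  [exact: d1|exact: d2].
- have -> : 'D_(1, 0) (fun u : R * R => f i u.1 u.2) = (fun u => f (i1 i) u.1 u.2);
  last exact: IH.
  by apply/funext => -[x y]; have [_ ->] := D1 x y.
- have -> : 'D_(0, 1) (fun u : R * R => f i u.1 u.2) = (fun u => f (i2 i) u.1 u.2);
  last exact: IH.
  by apply/funext => -[x y]; have [_ ->] := D2 x y.
Qed.

(** [gerf] is not a polynomial multiple of the Gaussian but all its derivatives are, hence the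
    separate case of order zero. *)
Definition gerf_derivatives (n : nat) : R -> R :=
  if n is m.+1 then fun x => 2 * pgam (iter m (@Dpgam R) 1) x else @gerf R.

Lemma is_derive_gerf_derivatives n (x : R) :
  is_derive x 1 (gerf_derivatives n) (gerf_derivatives n.+1 x).
Proof.
case: n => [|n] /=; first by rewrite pgam1; exact: is_derive_gerf.
have d := is_derive_pgam (iter n (@Dpgam R) 1) x.
by apply: is_derive_eq; rewrite /GRing.scale/=; ring.
Qed.

Lemma gerf_derivatives_bound n : exists B, forall x, `|gerf_derivatives n x| <= B.
Proof.
case: n => [|n] /=; first by exists 1; exact: gerf_le1.
have [C C0 HC] := pgam_bound (iter n (@Dpgam R) 1); exists (2 * C) => x.
rewrite normrM ger0_norm// ler_pM2l// (le_trans (HC x))// ler_piMr//.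
by rewrite -expR0 ler_expR oppr_le0 sqr_ge0.
Qed.

Definition heat_sg (alpha x y : R) : R :=
  \int[mu]_v (gam (y - v) * (Num.sg v * gerf (x + alpha * v))).

Lemma Ck_heat_sg (alpha : R) n : Ck n (fun u : R * R => heat_sg alpha u.1 u.2).
Proof.
(* The polynomial records the derivatives in [y], the natural number those in [x]. *)
pose f (i : {poly R} * nat) := gconv alpha (@Num.sg R) i.1 (gerf_derivatives i.2).
have -> : (fun u : R * R => heat_sg alpha u.1 u.2) = (fun u => f (1, 0%N) u.1 u.2).
  by apply/funext => u; rewrite /f /gconv /= pgam1.
have cg k := continuous_is_derive (is_derive_gerf_derivatives k).
apply: (@Ck_family _ f (fun i => (i.1, i.2.+1)) (fun i => (Dpgam i.1, i.2))) => -[p k] /=.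
- move=> x y; have [B HB] := gerf_derivatives_bound k.
  have [B' HB'] := gerf_derivatives_bound k.+1.
  apply: (@gconv_derive_x R alpha _ (@measurable_sgr R) (@normr_sgr_le1 R) p _ _
    (Num.max B B')).
  + exact: is_derive_gerf_derivatives.
  + exact: cg.
  + by move=> z; rewrite le_max HB.
  + by move=> z; rewrite le_max HB' orbT.
- move=> x y; have [B HB] := gerf_derivatives_bound k.
  exact: (@gconv_derive_y R alpha _ (@measurable_sgr R) (@normr_sgr_le1 R) p _ B).
- have [B HB] := gerf_derivatives_bound k.
  exact: (@gconv_bound R alpha _ (@measurable_sgr R) (@normr_sgr_le1 R) p _ B).
Qed.

End smoothness.

(** * The double integral M2 *)

Section M2.
Context (R : realType).
Notation mu := (@lebesgue_measure R).
Notation mu2 := (mu \x mu)%E.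

(** On the contour [z_j = x_j - i u_j] the exponent is real. *)
Lemma M2_integrand (alpha u1 u2 x1 x2 : R) : u1 != 0 -> u2 - alpha * u1 != 0 ->
  let z1 := x1 +i* (- u1) in let z2 := x2 +i* (- u2) in
  let y := x2 - alpha * x1 in let b := u2 - alpha * u1 in
  let E := expR (- pi * (u1 ^+ 2 + u2 ^+ 2)) * (gam x1 * gam x2) in
  let N := (u1 ^+ 2 + x1 ^+ 2) * (b ^+ 2 + y ^+ 2) in
  expC (- pi%:C * z1 ^+ 2 - pi%:C * z2 ^+ 2
            - 2 * pi%:C * (0 +i* 1) * (u1%:C * z1 + u2%:C * z2))
      / (z1 * (z2 - alpha%:C * z1)) =
  (E * (x1 * y - u1 * b) / N) +i* (E * (x1 * b + u1 * y) / N).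
Proof.
move=> u10 b0 z1 z2 y b E N.
have -> : - pi%:C * z1 ^+ 2 - pi%:C * z2 ^+ 2 - 2 * pi%:C * (0 +i* 1) * (u1%:C * z1 +
  u2%:C * z2)
  = (- pi * (u1 ^+ 2 + u2 ^+ 2) + (- pi * x1 ^+ 2 + - pi * x2 ^+ 2))%:C.
  by apply/eqP; rewrite eq_complex /=; apply/andP; split; apply/eqP; ring.
rewrite /expC /= sin0 cos0 !expRD -/(gam x1) -/(gam x2) -/E.
have N1 : u1 ^+ 2 + x1 ^+ 2 != 0 by rewrite gt_eqF// ltr_wpDr ?sqr_ge0// exprn_even_gt0.
have N2 : b ^+ 2 + y ^+ 2 != 0 by rewrite gt_eqF// ltr_wpDr ?sqr_ge0// exprn_even_gt0.
have D1 : z1 != 0 by rewrite eq_complex /= negb_and oppr_eq0 u10 orbT.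
have D2 : z2 - alpha%:C * z1 = y +i* (- b).
  by apply/eqP; rewrite eq_complex /=; apply/andP; split; apply/eqP; rewrite /y /b; ring.
have D20 : z2 - alpha%:C * z1 != 0 by rewrite D2 eq_complex /= negb_and oppr_eq0 b0 orbT.
apply: (mulIf (mulf_neq0 D1 D20)); rewrite divfK ?mulf_neq0// D2 /N.
move: (y) N2 => Y N2; move: (b) N2 => B N2; move: (E) => E'.
by apply/eqP; rewrite eq_complex /=; apply/andP; split; apply/eqP; field; rewrite N1 N2.
Qed.

(** Carrying both coefficients treats the real part ([c = 1, d = 0]) and the
    imaginary part ([c = 0, d = - 1]) of [M2] at once. *)
Definition trig (c d x : R) : R := c * cos x + d * sin x.

(** The pair [(d, - c)] is a quarter turn of [(c, d)]. A phase that is a sum over two variables thus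
    becomes a sum of two products, to which Fubini applies factor by factor. *)
Lemma trigD c d x y : trig c d (x + y) = cos x * trig c d y + sin x * trig d (- c) y.
Proof. by rewrite /trig cosD sinD; ring. Qed.

Lemma measurable_trig_fun c d : measurable_fun setT (trig c d).
Proof.
have := measurable_trig c d 1; congr measurable_fun.
by apply/funext => s; rewrite mul1r.
Qed.

(** The coefficients of [c] and [d] in the numerator are the real and imaginary parts of
    [(a + i x) (b + i y)]. *)
Lemma fourier_kern2 (a b c d x y : R) : a != 0 -> b != 0 ->
  \int[mu2]_w (kern a w.1 * kern b w.2 * trig c d (2 * pi * x * w.1 + 2 * pi * y * w.2)) =
  (c * (a * b - x * y) + d * (a * y + x * b)) / (pi ^+ 2 * ((a ^+ 2 +
    x ^+ 2) * (b ^+ 2 + y ^+ 2))).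
Proof.
move=> a0 b0.
have i1 e f := integrable_kern_trig e f (2 * pi * x) a0.
have i2 e f := integrable_kern_trig e f (2 * pi * y) b0.
transitivity (\int[mu2]_w ((kern a w.1 * trig 1 0 (2 * pi * x * w.1)) * (kern b w.2 *
  trig c d (2 * pi * y * w.2)) +
   (kern a w.1 * trig 0 1 (2 * pi * x * w.1)) * (kern b w.2 * trig d (- c) (2 * pi * y
     * w.2)))).
  by apply: eq_Rintegral => w _; rewrite trigD /trig; ring.
rewrite RintegralD//; [|exact: (integrable_prod (i1 1 0) (i2 c d))|exact:
  (integrable_prod (i1 0 1) (i2 d (- c)))].
rewrite (Rintegral_prod (i1 1 0) (i2 c d)) (Rintegral_prod (i1 0 1) (i2 d (- c)))
  !fourier_kern//.
have p0 : (pi : R) != 0 by rewrite gt_eqF ?pi_gt0.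
have N1 : a ^+ 2 + x ^+ 2 != 0 by rewrite gt_eqF// ltr_wpDr ?sqr_ge0// exprn_even_gt0.
have N2 : b ^+ 2 + y ^+ 2 != 0 by rewrite gt_eqF// ltr_wpDr ?sqr_ge0// exprn_even_gt0.
by move: (pi : R) p0 => P p0; field; rewrite N1 N2 p0.
Qed.

Lemma integrable_gam_trig (c d w : R) :
  mu.-integrable setT (EFin \o (fun s => gam s * (c * cos (w * s) + d * sin (w * s)))).
Proof.
apply: (@integrable_mulr_bounded _ _ _ _ _ _ (`|c| + `|d|)); first exact: measurable_trig.
  by move=> s; exact: normr_trig_le.
exact: integrable_gam.
Qed.

Lemma fourier_gam (c d x : R) :
  \int[mu]_s (gam s * (c * cos (2 * pi * x * s) + d * sin (2 * pi * x * s))) = c * gam x.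
Proof.
have ic := integrable_mul_cos (2 * pi * x) (@integrable_gam R).
have is' := integrable_mul_sin (2 * pi * x) (@integrable_gam R).
transitivity (\int[mu]_s (c * (gam s * cos (2 * pi * x * s)) +
  d * (gam s * sin (2 * pi * x * s)))).
  by apply: eq_Rintegral => s _; ring.
rewrite RintegralD//; [|exact: integrable_scale|exact: integrable_scale].
rewrite (RintegralZl c measurableT ic) (RintegralZl d measurableT is').
by rewrite fourier_cos_gam fourier_sin_gam mulr0 addr0.
Qed.

(** The Gaussian is even, so the sine parts vanish and [d] disappears; this is why [M2] is real. *)
Lemma fourier_gam2 (c d p q : R) :
  \int[mu2]_z (gam z.1 * gam z.2 * trig c d (2 * pi * p * z.1 + 2 * pi * q * z.2)) =
  c * (gam p * gam q).
Proof.
have i1 e f := integrable_gam_trig e f (2 * pi * p).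
have i2 e f := integrable_gam_trig e f (2 * pi * q).
transitivity (\int[mu2]_w ((gam w.1 * trig 1 0 (2 * pi * p * w.1)) * (gam w.2 * trig c
  d (2 * pi * q * w.2)) +
   (gam w.1 * trig 0 1 (2 * pi * p * w.1)) * (gam w.2 * trig d (- c) (2 * pi * q *
     w.2)))).
  by apply: eq_Rintegral => w _; rewrite trigD /trig; ring.
rewrite RintegralD//; [|exact: (integrable_prod (i1 1 0) (i2 c d))|exact:
  (integrable_prod (i1 0 1) (i2 d (- c)))].
by rewrite (Rintegral_prod (i1 1 0) (i2 c d)) (Rintegral_prod (i1 0 1) (i2 d (- c)))
  !fourier_gam; ring.
Qed.

Lemma measurable_phase (alpha : R) : measurable_fun setT (fun zw : (R * R) * (R * R) =>
  2 * pi * (zw.2.1 * zw.1.1 + zw.2.2 * (zw.1.2 - alpha * zw.1.1))).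
Proof.
have m11 : measurable_fun setT (fun zw : (R * R) * (R * R) => zw.1.1).
  exact: (measurableT_comp (@measurable_fst _ _ _ _)).
have m12 : measurable_fun setT (fun zw : (R * R) * (R * R) => zw.1.2).
  exact: (measurableT_comp (@measurable_snd _ _ _ _)).
have m21 : measurable_fun setT (fun zw : (R * R) * (R * R) => zw.2.1).
  exact: (measurableT_comp (@measurable_fst _ _ _ _)).
have m22 : measurable_fun setT (fun zw : (R * R) * (R * R) => zw.2.2).
  exact: (measurableT_comp (@measurable_snd _ _ _ _)).
apply: measurable_funM => //.
apply: measurable_funD; first exact: measurable_funM.
apply: measurable_funM => //; apply: measurable_funB => //.
exact: measurable_funM.
Qed.

Lemma gam_le1 (x : R) : gam x <= 1.
Proof. by rewrite /gam -expR0 ler_expR mulNr oppr_le0 mulr_ge0 ?pi_ge0 ?sqr_ge0. Qed.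

Lemma integrable_kern_gam (alpha a b : R) : a != 0 -> b != 0 ->
  mu2.-integrable setT (EFin \o (fun w : R * R =>
    kern a w.1 * kern b w.2 * (gam (w.1 - alpha * w.2) * gam w.2))).
Proof.
move=> a0 b0; have ik := integrable_prod (integrable_kern a0) (integrable_kern b0).
apply: (@integrable_mulr_bounded _ _ _ _ _ _ 1) ik.
- apply: measurable_funM.
    apply: (measurableT_comp (@measurable_gam R)).
    by apply: measurable_funB => //; exact: measurable_funM.
  exact: (measurableT_comp (@measurable_gam R)).
- by move=> w; rewrite normrM !ger0_norm ?gam_ge0// mulr_ile1 ?gam_ge0 ?gam_le1.
Qed.

(** Both sides integrate the same function [F] of four variables. Integrating over [w] first yields
    the poles. Integrating over [z] first yields the Gaussian at [(w1 - alpha w2, w2)], because the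
    phase [w1 z1 + w2 (z2 - alpha z1)] equals [(w1 - alpha w2) z1 + w2 z2]. *)
Lemma parseval_kern (alpha a b c d : R) : a != 0 -> b != 0 ->
  let K (z : R * R) := gam z.1 * gam z.2 *
   ((c * (a * b - z.1 * (z.2 - alpha * z.1)) + d * (a * (z.2 - alpha * z.1) + z.1 * b)) /
     (pi ^+ 2 * ((a ^+ 2 + z.1 ^+ 2) * (b ^+ 2 + (z.2 - alpha * z.1) ^+ 2)))) in
  mu2.-integrable setT (EFin \o K) /\
  \int[mu2]_z K z =
  c * \int[mu2]_w (kern a w.1 * kern b w.2 * (gam (w.1 - alpha * w.2) * gam w.2)).
Proof.
move=> a0 b0 K.
pose F (z w : R * R) := (gam z.1 * gam z.2) * (kern a w.1 * kern b w.2) *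
    trig c d (2 * pi * (w.1 * z.1 + w.2 * (z.2 - alpha * z.1))).
have ik := integrable_prod (integrable_kern a0) (integrable_kern b0).
have ig := integrable_prod (@integrable_gam R) (@integrable_gam R).
have KE z : \int[mu2]_w F z w = K z.
  rewrite /K -(fourier_kern2 c d z.1 (z.2 - alpha * z.1) a0 b0) -RintegralZl//;
    last first.
    apply: (@integrable_mulr_bounded _ _ _ _ _ _ (`|c| + `|d|)) ik.
    - apply: measurableT_comp; first exact: measurable_trig_fun.
      by apply: measurable_funD; exact: measurable_funM.
    - by move=> x; exact: normr_trig_le.
  apply: eq_Rintegral => w _; rewrite /F /= !mulrA; congr (_ * trig c d _).
  ring.
have GE w : \int[mu2]_z F z w = c * (kern a w.1 * kern b w.2 * (gam (w.1 - alpha * w.2)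
  * gam w.2)).
  rewrite mulrCA -(fourier_gam2 c d) -RintegralZl//; last first.
    apply: (@integrable_mulr_bounded _ _ _ _ _ _ (`|c| + `|d|)) ig.
    - apply: measurableT_comp; first exact: measurable_trig_fun.
      by apply: measurable_funD; exact: measurable_funM.
    - by move=> x; exact: normr_trig_le.
  apply: eq_Rintegral => z _; rewrite /F /= mulrA [in RHS]mulrA; congr (_ * trig c d _).
    by ring.
  ring.
have ikg := integrable_kern_gam alpha a0 b0.
have mT := measurableT_comp (@measurable_trig_fun c d) (@measurable_phase alpha).
pose M := sigma_finite_product mu mu.
have [iF EF] := @Rfubini_bounded _ _ _ _ R M M _ _ _ _ ig ik mT (fun zw =>
  normr_trig_le c d _).
split.
  by apply: eq_integrable iF => // z _ /=; rewrite -KE.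
transitivity (\int[mu2]_z \int[mu2]_w F z w).
  by apply: eq_Rintegral => z _; rewrite KE.
rewrite [LHS]EF -(RintegralZl c measurableT ikg).
by apply: eq_Rintegral => w _; rewrite GE.
Qed.

End M2.

(** * Identification of E2 *)

Section E2.
Context (R : realType).
Notation mu := (@lebesgue_measure R).
Notation mu2 := (mu \x mu)%E.

Lemma integrable_sg_gam (sg q : R) :
  mu.-integrable setT (EFin \o (fun s => (sg + Num.sg s) * gam (q + s))).
Proof.
have [i1 _] := Rintegral_transl q (@integrable_gam R).
apply: (@integrable_mull_bounded _ _ _ _ _ _ (`|sg| + 1)).
- by apply: measurable_funD => //; exact: measurable_sgr.
- by move=> s; rewrite (le_trans (ler_normD _ _))// lerD2l normr_sgr_le1.
- by apply: eq_integrable i1 => // s _ /=; rewrite addrC.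
Qed.

Lemma Rintegral_sg_gam (sg q : R) :
  \int[mu]_s ((sg + Num.sg s) * gam (q + s)) = sg - gerf q.
Proof.
have i1 := integrable_gam_sub (- q).
have i2 : mu.-integrable setT (EFin \o (fun v => gam (- q - v) * Num.sg v)).
  by apply: eq_integrable (integrable_mul_sg 1 0 i1) => // v _ /=; rewrite mul1r addr0.
transitivity (\int[mu]_s (sg * gam (- q - s) + gam (- q - s) * Num.sg s)).
  by apply: eq_Rintegral => s _; rewrite -gamN opprD; ring.
rewrite (RintegralD measurableT (integrable_scale sg i1) i2) (RintegralZl sg
  measurableT i1).
by rewrite Rintegral_gam_sub gerf_conv gerfN mulr1.
Qed.

(** The linear exponents of the two kernels and the prefactor complete the squares to
    [gam (u1 + s - alpha t) * gam (u2 + t)]. The integral over [s] is then one-dimensional and gives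
    [sgA - gerf (u1 - alpha t)]. *)
Lemma Rintegral_kern_gam (alpha u1 u2 : R) : u1 != 0 -> u2 - alpha * u1 != 0 ->
  let sgA := Num.sg u1 in let sgB := Num.sg (u2 - alpha * u1) in
  expR (- pi * (u1 ^+ 2 + u2 ^+ 2)) *
    \int[mu2]_w (kern u1 w.1 * kern (u2 - alpha * u1) w.2 * (gam (w.1 - alpha * w.2) *
      gam w.2)) =
  sgA * sgB - sgA * gerf u2 - sgB * gerf ((u1 + alpha * u2) / Num.sqrt (1 + alpha ^+ 2))
  + heat_sg alpha u1 u2.
Proof.
move=> u10 b0 sgA sgB; set E := expR _.
have ikg := integrable_kern_gam alpha u10 b0.
have iS := integrable_scale E ikg.
rewrite -(RintegralZl E measurableT ikg) -(Rfubini2 iS).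
transitivity (\int[mu]_t ((sgB + Num.sg t) * gam (u2 +
  t) * (sgA - gerf (u1 - alpha * t)))).
  apply: eq_Rintegral => t _; rewrite -Rintegral_sg_gam -RintegralZl//;
    last exact: integrable_sg_gam.
  apply: eq_Rintegral => s _ /=; rewrite /kern -/sgA -/sgB /E /gam.
  have aux (A B F e1 e2 e3 e4 : R) : F * (A * e1 * (B * e2) * (e3 * e4)) =
    A * B * (F * (e1 * e2 * (e3 * e4))) by ring.
  have aux' (A B e1 e2 : R) : B * e1 * (A * e2) = A * B * (e1 * e2) by ring.
  rewrite [LHS]aux [RHS]aux' -!expRD; congr (_ * _); congr (expR _); ring.
have mg : measurable_fun setT (fun t : R => gerf (u1 + alpha * t)).
  apply: (measurableT_comp (@measurable_gerf R)).
  by apply: measurable_funD => //; exact: measurable_funM.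
have i0 := integrable_gam_sub u2.
have i1 : mu.-integrable setT (EFin \o (fun v => gam (u2 - v) * Num.sg v)).
  by apply: eq_integrable (integrable_mul_sg 1 0 i0) => // v _ /=; rewrite mul1r addr0.
have i2 := @integrable_mulr_bounded _ _ R mu _ (fun v => gam (u2 - v)) 1 mg (fun t =>
  gerf_le1 (u1 + alpha * t)) i0.
have i3 := @integrable_mulr_bounded _ _ R mu _ (fun v => gam (u2 - v) * Num.sg v) 1 mg
  (fun t => gerf_le1 (u1 + alpha * t)) i1.
(* The expanded integrand after [t = - v]. Its terms integrate by the mass of the Gaussian,
   [gerf_conv], [gconv_gerf] and the definition of [heat_sg], respectively. *)
pose h v := sgA * sgB * gam (u2 - v) + (- sgA) * (gam (u2 - v) * Num.sg v) +
  (- sgB) * (gam (u2 - v) * gerf (u1 + alpha * v)) +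
    gam (u2 - v) * Num.sg v * gerf (u1 + alpha * v).
have j1 := integrable_add (integrable_scale (sgA * sgB) i0) (integrable_scale (- sgA) i1).
have j2 := integrable_add j1 (integrable_scale (- sgB) i2).
have ih : mu.-integrable setT (EFin \o h) := integrable_add j2 i3.
have [_ hN] := Rintegral_opp ih.
transitivity (\int[mu]_v h v).
  by rewrite -hN; apply: eq_Rintegral => t _; rewrite /h opprK sgrN (mulrN alpha t); ring.
rewrite (RintegralD measurableT j2 i3) (RintegralD measurableT j1 (integrable_scale (-
  sgB) i2)).
rewrite (RintegralD measurableT (integrable_scale (sgA * sgB) i0) (integrable_scale (-
  sgA) i1)).
rewrite (RintegralZl _ measurableT i0) (RintegralZl _ measurableT i1) (RintegralZl _
  measurableT i2).
rewrite Rintegral_gam_sub gerf_conv gconv_gerf mulr1 !mulNr; congr (_ + _).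
by apply: eq_Rintegral => v _; rewrite mulrA.
Qed.

(** The numerator here is the opposite of the one in [parseval_kern], which absorbs the minus sign
    in front of [M2]; the factor [pi ^- 2] cancels the one produced by the two kernels. *)
Lemma M2_iterated (alpha u1 u2 c d : R) : u1 != 0 -> u2 - alpha * u1 != 0 ->
  let b := u2 - alpha * u1 in
  - (pi ^- 2) * \int[mu]_x1 \int[mu]_x2
     (expR (- pi * (u1 ^+ 2 + u2 ^+ 2)) * (gam x1 * gam x2) *
      (c * (x1 * (x2 - alpha * x1) - u1 * b) - d * (x1 * b + u1 * (x2 - alpha * x1))) /
      ((u1 ^+ 2 + x1 ^+ 2) * (b ^+ 2 + (x2 - alpha * x1) ^+ 2))) =
  c * (expR (- pi * (u1 ^+ 2 + u2 ^+ 2)) *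
    \int[mu2]_w (kern u1 w.1 * kern b w.2 * (gam (w.1 - alpha * w.2) * gam w.2))).
Proof.
move=> u10 b0 b; set E := expR _.
pose K (z : R * R) : R := gam z.1 * gam z.2 *
   ((c * (u1 * b - z.1 * (z.2 - alpha * z.1)) + d * (u1 * (z.2 - alpha * z.1) +
     z.1 * b)) /
     (pi ^+ 2 * ((u1 ^+ 2 + z.1 ^+ 2) * (b ^+ 2 + (z.2 - alpha * z.1) ^+ 2)))).
have [iK EK] : mu2.-integrable setT (EFin \o K) /\ \int[mu2]_z K z =
  c * \int[mu2]_w (kern u1 w.1 * kern b w.2 * (gam (w.1 - alpha * w.2) * gam w.2)).
  exact: (parseval_kern alpha c d u10 b0).
have iS := integrable_scale (- (pi ^+ 2) * E) iK.
have p0 : (pi : R) != 0 by rewrite gt_eqF ?pi_gt0.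
transitivity (- pi ^- 2 * \int[mu2]_z (- (pi ^+ 2) * E * K z)); last first.
  rewrite (RintegralZl _ measurableT iK) EK.
  by move: (Rintegral _ _ _) (E) => J F; move: (pi : R) p0 => P p0; field.
congr (_ * _); rewrite -(Rfubini1 iS).
apply: eq_Rintegral => x1 _; apply: eq_Rintegral => x2 _ /=.
have N1 : u1 ^+ 2 + x1 ^+ 2 != 0 by rewrite gt_eqF// ltr_wpDr ?sqr_ge0// exprn_even_gt0.
have N2 : b ^+ 2 + (x2 - alpha * x1) ^+ 2 != 0 by rewrite gt_eqF// ltr_wpDr ?sqr_ge0//
  exprn_even_gt0.
rewrite /K /=; move: (b) (E) (gam x1) (gam x2) N2 => B F g1 g2 N2.
by move: (pi : R) p0 => P p0; field; rewrite N1 N2 p0.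
Qed.

Lemma M2E (alpha u1 u2 : R) : u1 != 0 -> u2 - alpha * u1 != 0 ->
  M2 alpha u1 u2 = (Num.sg u1 * Num.sg (u2 - alpha * u1) - Num.sg u1 * gerf u2
    - Num.sg (u2 - alpha * u1) * gerf ((u1 + alpha * u2) / Num.sqrt (1 + alpha ^+ 2))
    + heat_sg alpha u1 u2)%:C.
Proof.
move=> u10 b0; rewrite -Rintegral_kern_gam//.
set b := u2 - alpha * u1; set E := expR _; set J := Rintegral _ _ _.
pose I c d := \int[mu]_x1 \int[mu]_x2 (E * (gam x1 * gam x2) *
      (c * (x1 * (x2 - alpha * x1) - u1 * b) - d * (x1 * b + u1 * (x2 - alpha * x1))) /
      ((u1 ^+ 2 + x1 ^+ 2) * (b ^+ 2 + (x2 - alpha * x1) ^+ 2))).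
have IE c d : - (pi ^- 2) * I c d = c * (E * J) by exact: M2_iterated.
have -> : M2 alpha u1 u2 = - (pi ^- 2)%:C * (I 1 0 +i* I 0 (- 1)).
  pose F x1 x2 : R[i] := (E * (gam x1 * gam x2) * (x1 * (x2 - alpha * x1) - u1 * b) /
      ((u1 ^+ 2 + x1 ^+ 2) * (b ^+ 2 + (x2 - alpha * x1) ^+ 2))) +i*
    (E * (gam x1 * gam x2) * (x1 * b + u1 * (x2 - alpha * x1)) /
      ((u1 ^+ 2 + x1 ^+ 2) * (b ^+ 2 + (x2 - alpha * x1) ^+ 2))).
  transitivity (- (pi ^- 2)%:C * cintegral (fun x1 => cintegral (F x1))).
    apply: (congr1 (fun z => - (pi ^- 2)%:C * z)); apply: (congr1 (@cintegral R)).
    apply/funext => x1; apply: (congr1 (@cintegral R)); apply/funext => x2.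
    exact: M2_integrand.
  apply: (congr1 (fun z => - (pi ^- 2)%:C * z)); rewrite {1}/cintegral.
  apply: congr2; apply: eq_Rintegral => x1 _; apply: eq_Rintegral => x2 _ /=.
    by rewrite mul1r mul0r subr0.
  by rewrite mul0r sub0r mulN1r opprK.
have I0 : I 0 (- 1) = 0.
  apply/eqP; rewrite -(mulrI_eq0 (x := - (pi ^- 2))); last first.
    by apply/lregP; rewrite oppr_eq0 invr_eq0 expf_eq0/= gt_eqF ?pi_gt0.
  by rewrite IE mul0r.
rewrite I0 -[in RHS](mul1r (E * J)) -(IE 1 0).
by apply/eqP; rewrite eq_complex /=; apply/andP; split; apply/eqP; ring.
Qed.

(** The signs in the definition of [E2] compensate exactly those produced by [M2]:
    [u1] and [u1 + alpha u2] have different signs only in sectors where [u2] and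
    [u2 - alpha u1] have the same sign. *)
Lemma sg_sectors (alpha u1 u2 : R) : u1 != 0 -> u2 - alpha * u1 != 0 ->
  (Num.sg u1 - Num.sg (u1 + alpha * u2)) * (Num.sg (u2 - alpha * u1) - Num.sg u2) = 0.
Proof.
move=> u10 b0; apply/eqP; rewrite mulf_eq0 !subr_eq0.
case: (ltrgt0P u2) => [c0|c0|c0]; last by rewrite c0 mulr0 addr0 eqxx.
- case: (ltrgt0P (u2 - alpha * u1)) b0 => [b0|b0|->]; rewrite ?eqxx// => _.
    by rewrite (gtr0_sg b0) (gtr0_sg c0) eqxx orbT.
  have au : 0 < alpha * u1 by lra.
  case: (ltrgt0P u1) u10 => [a0|a0|->]; rewrite ?eqxx// => _.
    have al : 0 < alpha by move: au; rewrite pmulr_lgt0.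
    have d0 : 0 < u1 + alpha * u2 by rewrite addr_gt0// mulr_gt0.
    by rewrite (gtr0_sg a0) (gtr0_sg d0) eqxx.
  have al : alpha < 0 by move: au; rewrite nmulr_lgt0.
  have d0 : u1 + alpha * u2 < 0 by nra.
  by rewrite (ltr0_sg a0) (ltr0_sg d0) eqxx.
- case: (ltrgt0P (u2 - alpha * u1)) b0 => [b0|b0|->]; rewrite ?eqxx// => _; last first.
    by rewrite (ltr0_sg b0) (ltr0_sg c0) eqxx orbT.
  have au : alpha * u1 < 0 by lra.
  case: (ltrgt0P u1) u10 => [a0|a0|->]; rewrite ?eqxx// => _.
    have al : alpha < 0 by move: au; rewrite pmulr_llt0.
    have d0 : 0 < u1 + alpha * u2 by nra.
    by rewrite (gtr0_sg a0) (gtr0_sg d0) eqxx.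
  have al : 0 < alpha by move: au; rewrite nmulr_llt0.
  have d0 : u1 + alpha * u2 < 0 by nra.
  by rewrite (ltr0_sg a0) (ltr0_sg d0) eqxx.
Qed.

(** Once [M1] is split, the [gerf] terms cancel. The remaining signs [A B - A C - B D + C D] factor
    as [(A - D) (B - C)], the product treated in [sg_sectors]. *)
Lemma E2_formulaE (alpha : R) (u : R * R) : u \in E2_domain alpha ->
  E2_formula alpha u = (heat_sg alpha u.1 u.2)%:C.
Proof.
case: u => u1 u2; rewrite inE => -[/= u10]; rewrite -subr_eq0 => b0.
rewrite /E2_formula /= M2E// !M1E -raddfD /=; congr (_%:C).
have h := sg_sectors u10 b0.
set k := Num.sqrt _.
have -> : Num.sg ((u1 + alpha * u2) / k) = Num.sg (u1 + alpha * u2).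
  by rewrite sgrM sgrV (gtr0_sg (x := k)) ?mulr1// sqrtr_gt0 ltr_wpDr ?sqr_ge0.
move: h; set A := Num.sg u1; set B := Num.sg (u2 - _); set C := Num.sg u2;
  set D := Num.sg (_ + _) => h.
apply/eqP; rewrite -subr_eq0 -h; apply/eqP; ring.
Qed.

(** The first coordinate is moved off zero, and only then the second off [alpha * x], by at most
    [e / 2] each. *)
Lemma dense_E2_domain (alpha : R) : dense (E2_domain alpha).
Proof.
move=> U [[a b] Uab] oU.
have /nbhs_ballP[e /= e0 eU] : nbhs (a, b) U by apply: open_nbhs_nbhs.
have [x [x0 xa]] : exists x : R, x != 0 /\ `|a - x| < e.
  case: (eqVneq a 0) => [->|a0]; last by exists a; rewrite subrr normr0.
  exists (e / 2); rewrite gt_eqF ?divr_gt0//; split=> //.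
  by rewrite sub0r normrN gtr0_norm ?divr_gt0// ltr_pdivrMr// ltr_pMr// ltr1n.
have [y [y0 yb]] : exists y : R, y != alpha * x /\ `|b - y| < e.
  case: (eqVneq b (alpha * x)) => [->|b0]; last by exists b; rewrite subrr normr0.
  exists (alpha * x + e / 2); split.
    by rewrite -subr_eq0 addrAC subrr add0r gt_eqF// divr_gt0.
  by rewrite opprD addrA subrr sub0r normrN gtr0_norm ?divr_gt0// ltr_pdivrMr//
    ltr_pMr// ltr1n.
by exists (x, y); split=> //; apply: eU; split.
Qed.

Lemma eq_on_dense (f g : R * R -> R) (D : set (R * R)) : dense D ->
  continuous f -> continuous g -> {in D, f =1 g} -> f = g.
Proof.
move=> dD cf cg fg; apply/funext => u; apply/eqP; rewrite -subr_eq0;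
  apply/negP => /negP h.
pose h' (v : R * R) : R := f v - g v.
have ch : continuous h' by move=> v; apply: cvgB; [exact: cf|exact: cg].
have oU : open (h' @^-1` [set x | x != 0]).
  by apply: open_comp; [move=> v _; exact: ch|exact: (@open_neq R 0)].
have [] := dD _ _ oU; first by exists u.
by move=> v [/= hv Dv]; move: hv; rewrite /h' fg ?subrr ?eqxx// inE.
Qed.

Lemma Ck_cst n (c : R) : Ck n (cst c : R * R -> R).
Proof.
elim: n c => [|n IH] c /=; first exact: cst_continuous.
split; first exact: cst_continuous.
- by move=> u; split; exact: derivable_cst.
- have -> : 'D_(1, 0) (cst c : R * R -> R) = cst 0; last exact: IH.
  by apply/funext => u; exact: derive_cst.
- have -> : 'D_(0, 1) (cst c : R * R -> R) = cst 0; last exact: IH.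
  by apply/funext => u; exact: derive_cst.
Qed.

(** [E2] is a chosen element: [G] shows that there is something to choose, which excludes the
    default value, and whatever is chosen agrees with [G] by continuity. *)
Lemma E2E (alpha : R) : E2 alpha = (fun u => (heat_sg alpha u.1 u.2)%:C).
Proof.
pose G (u : R * R) := (heat_sg alpha u.1 u.2)%:C.
have sG : smooth G by move=> n; split; [exact: Ck_heat_sg|exact: Ck_cst].
have GE : {in E2_domain alpha, G =1 E2_formula alpha}.
  by move=> u uD; rewrite E2_formulaE.
rewrite /E2; case: xgetP => [E _ [sE EE]|/(_ G)]; last by case.
have EG : {in E2_domain alpha, E =1 G} by move=> u uD; rewrite EE// GE.
have [cRE cIE] := sE 0%N; have [cRG cIG] := sG 0%N.
have dD := @dense_E2_domain alpha.
have hR := eq_on_dense dD cRE cRG (fun u uD => congr1 (@complex.Re R) (EG u uD)).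
have hI := eq_on_dense dD cIE cIG (fun u uD => congr1 (@complex.Im R) (EG u uD)).
apply/funext => u; apply/eqP; rewrite eq_complex; apply/andP; split; apply/eqP.
  exact: (congr1 (fun f => f u) hR).
exact: (congr1 (fun f => f u) hI).
Qed.

(** For fixed [v2], the shift of [v1] by [alpha * v2] turns the inner integral into the
    one-dimensional average [gerf (u1 + alpha v2)]. *)
Lemma heat_sg_plane (alpha u1 u2 : R) :
  \int[mu2]_v (expR (- pi * (u1 - v.1) ^+ 2 - pi * (u2 - v.2) ^+ 2)
        * Num.sg v.2 * Num.sg (v.1 + alpha * v.2)) = heat_sg alpha u1 u2.
Proof.
have i1 := integrable_gam_sub u1; have i2 := integrable_gam_sub u2.
have ms : measurable_fun setT (fun v : R * R => Num.sg v.2 * Num.sg (v.1 + alpha * v.2)).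
  apply: measurable_funM; apply: (measurableT_comp (@measurable_sgr R)) => //.
  by apply: measurable_funD => //; exact: measurable_funM.
have sM (v : R * R) : `|Num.sg v.2 * Num.sg (v.1 + alpha * v.2)| <= 1.
  by rewrite normrM mulr_ile1 ?normr_sgr_le1.
have iS := @integrable_mulr_bounded _ _ R mu2 _ _ 1 ms sM (integrable_prod i1 i2).
transitivity (\int[mu2]_v (gam (u1 - v.1) * gam (u2 - v.2) * (Num.sg v.2 * Num.sg (v.1
  + alpha * v.2)))).
  by apply: eq_Rintegral => v _; rewrite expRD mulNr /gam !mulNr !mulrA.
rewrite -(Rfubini2 iS); apply: eq_Rintegral => y _ /=.
have i3 x : mu.-integrable setT (EFin \o (fun v => gam (x - v) * Num.sg v)).
  by apply: eq_integrable (integrable_mul_sg 1 0 (integrable_gam_sub x)) => // v _ /=;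
    rewrite mul1r addr0.
have [i4 E4] := Rintegral_transl (alpha * y) (i3 (u1 + alpha * y)).
rewrite -gerf_conv -E4 mulrA -RintegralZl//.
by apply: eq_Rintegral => x _; rewrite (_ : u1 + alpha * y - (x + alpha * y) = u1 - x);
  ring.
Qed.

End E2.

Theorem theorem3p11 (R : realType) (alpha u1 u2 : R) :
  E2 alpha (u1, u2) =
    (\int[(@lebesgue_measure R \x @lebesgue_measure R)%E]_v
       (expR (- pi * (u1 - v.1) ^+ 2 - pi * (u2 - v.2) ^+ 2)
        * Num.sg v.2 * Num.sg (v.1 + alpha * v.2)))%:C
  /\
  E2 alpha (u1, u2) =
    (heat_operator (4 * pi)^-1
       (fun v : R * R => Num.sg v.2 * Num.sg (v.1 + alpha * v.2)) (u1, u2))%:C.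
Proof.
rewrite E2E /= heat_sg_plane; split=> //; congr (_%:C).
(* At [t = (4 pi)^-1] the heat kernel has prefactor one and exponent [- pi |u - v|^2]. *)
rewrite -heat_sg_plane /heat_operator; apply: eq_Rintegral => v _ /=.
have p0 : (4 * pi : R) != 0 by rewrite mulf_neq0// gt_eqF ?pi_gt0.
rewrite mulfV// invr1 mul1r -mulrA; congr (expR _ * _).
have q0 : (pi : R) != 0 by rewrite gt_eqF ?pi_gt0.
by move: (pi : R) q0 => P q0; field.
Qed.
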